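(* For all integers $n\geq 0$ and $j\in\{3,4,6\}$, we have $$\sum_{k=-\infty}^\infty (6k+1)B\left(49n+7j+2-7k(3k+1)\right)\equiv 0\pmod{7}$$ and $$\sum_{k=-\infty}^\infty (6k+1)B\left(343n+49j+16-7k(3k+1)\right)\equiv 0\pmod{7}.$$
   Context: For $m\in\mathbb{N}$ and $|q|<1$ let $f_m:=\prod_{n\geq 1}(1-q^{mn})$. $B(n)$ denotes the number of partition triples $\pi=(\pi_1,\pi_2,\pi_3)$ of $n$ (the sum of all parts of $\pi_1,\pi_2,\pi_3$ is $n$; empty partitions are allowed) such that $\pi_1$ and $\pi_2$ each consist of distinct odd parts and $\pi_3$ consists of parts divisible by $4$. Equivalently, $\sum_{n=0}^\infty B(n)q^n=\dfrac{f_2^4}{f_1^2f_4^3}$. Convention: $B(m)=0$ for every negative integer $m$, so the sums over $k\in\mathbb{Z}$ have only finitely many nonzero terms. *)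

(* Defs.v *)
From HB Require Import structures.
From mathcomp Require Import all_boot all_order all_algebra.
From mathcomp Require Import zify.
From mathcomp Require Import all_classical.
Set Implicit Arguments.
Unset Strict Implicit.
Unset Printing Implicit Defensive.
Import Order.TTheory GRing.Theory Num.Theory.

Definition is_partition (s : seq nat) : bool :=
  sorted geq s && (0 \notin s).

Definition is_partition_triple (n : nat) (s1 s2 s3 : seq nat) : bool :=
  [&& [&& is_partition s1, is_partition s2 & is_partition s3],
      [&& uniq s1 & all odd s1],
      [&& uniq s2 & all odd s2],
      all (dvdn 4) s3
    & sumn s1 + sumn s2 + sumn s3 == n].

(* Every component of such a triple has at most n parts, all of them at most n
   ([is_partition_triple_bounded] below), so the triples can be counted in a
   finite type. *)
Definition parts_upto (n : nat) : finType := n.-bseq 'I_n.+1.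

Definition parts (n : nat) (b : parts_upto n) : seq nat := [seq val i | i <- b].

Definition Bnat (n : nat) : nat :=
  #|[set t : parts_upto n * parts_upto n * parts_upto n |
      is_partition_triple n (parts t.1.1) (parts t.1.2) (parts t.2)]|.

Definition B (m : int) : nat := if m is Posz n then Bnat n else 0.

Lemma parts_inj (n : nat) : injective (@parts n).
Proof. by move=> a b /(inj_map val_inj) /val_inj. Qed.

Lemma parts_upto_surj (n : nat) (s : seq nat) :
  0 \notin s -> sumn s <= n -> exists b : parts_upto n, parts b = s.
Proof.
move=> s0 sn.
have size_s : size s <= sumn s.
  elim: s s0 {sn} => //= a s IH.
  by rewrite inE negb_or => /andP[a0 /IH]; lia.
have le_s : forall x, x \in s -> x <= sumn s.
  move: {s0 sn size_s} s; elim=> //= a s IH x.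
  by rewrite inE => /orP[/eqP->|/IH]; lia.
have sz : size [seq inord x : 'I_n.+1 | x <- s] <= n.
  by rewrite size_map (leq_trans size_s).
exists (Bseq sz); rewrite /parts /= -map_comp -[RHS]map_id.
apply/eq_in_map => x /le_s xs /=.
by rewrite inordK // ltnS (leq_trans xs).
Qed.

Lemma is_partition_triple_bounded (n : nat) (s1 s2 s3 : seq nat) :
  is_partition_triple n s1 s2 s3 ->
  exists b : parts_upto n * parts_upto n * parts_upto n,
    [/\ parts b.1.1 = s1, parts b.1.2 = s2 & parts b.2 = s3].
Proof.
case/and5P=> /and3P[/andP[_ z1] /andP[_ z2] /andP[_ z3]] _ _ _ /eqP sn.
have [||b1 e1] := @parts_upto_surj n s1; [by []|by lia|].
have [||b2 e2] := @parts_upto_surj n s2; [by []|by lia|].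
have [||b3 e3] := @parts_upto_surj n s3; [by []|by lia|].
by exists (b1, b2, b3).
Qed.

Local Open Scope classical_set_scope.
Local Open Scope ring_scope.

(* A sum [\sum_(k \in A) F k] is 0 by convention when F has infinite support
   on A; this does not happen for the sums considered here. *)
Lemma B_sum_finite_support (N : int) :
  finite_set [set k : int |
    (6 * k + 1) * (B (N - 7 * k * (3 * k + 1)))%:Z != 0].
Proof.
pose r : seq int := [seq i%:Z - (absz N)%:Z | i <- iota 0 (2 * absz N).+1].
apply: (@sub_finite_set _ _ [set` r]); last exact: finite_seq.
move=> k /= nz; have : 0 <= N - 7 * k * (3 * k + 1).
  by move: nz; case: (N - _) => // m; rewrite mulr0 eqxx.
move=> Nk; have kN : (absz k <= absz N)%N by nia.
apply/mapP; exists (absz (k + (absz N)%:Z)); last by lia.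
by rewrite mem_iota; lia.
Qed.

(* Main.v *)
From HB Require Import structures.
Require Import Defs.
From mathcomp Require Import all_boot all_order all_algebra all_field.
From mathcomp Require Import zify ring.
From mathcomp Require Import all_classical.
Set Implicit Arguments.
Unset Strict Implicit.
Unset Printing Implicit Defensive.
Import Order.TTheory GRing.Theory Num.Theory.

Local Open Scope classical_set_scope.
Local Open Scope ring_scope.

(** Write [f_m] for [prod_(n >= 1) (1 - q^(m n))], [phi(q)] for [sum_k
    q^(k^2)] and [U] for the operator that sends [sum c_n q^n] to [sum c_(7 n
    + 2) q^n]. The generating function [b] of [B] is [phi / (f_2 f_4)], and
    the sums of the theorem are coefficients of [chi(q^14) b] with [chi =
    sum_k (6 k + 1) q^(k (3 k + 1) / 2) = f_1^5 / f_2^2].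

    Modulo 7 one has [U b = phi^3 f_2 f_4] ([sec_phi_quotient]). As [chi(q^2)
    = f_2^5 / f_4^2] and seventh powers are series in [q^7], this gives [U
    (chi(q^14) b) = f_1(q) f_1(-q^7)] ([sec_weighted]). The exponents in
    [f_1] are the pentagonal numbers, which are never 3, 4 or 6 modulo 7:
    this is the first congruence. A pentagonal number that is 2 modulo 7 is 2
    modulo 49, so that a second application of [U] leaves a series in [q^7]
    times [f_1(-q)], which has the same exponents as [f_1]: this is the
    second one.

    The formula for [U b] comes from the derivation [D = q d/dq]. On series
    over the field with 7 elements, [1 - (D - 2)^6] keeps exactly the
    exponents that are 2 modulo 7, so it suffices to compute [(D - 2)^6 h]
    for [h = phi (f_2 f_4)^6], which is [b] times a series in [q^7]. With [x
    = phi(q)^4], [y = phi(-q)^4] and [al = D phi / phi], the logarithmic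
    derivatives of [phi(-q)], [f_1], [f_2] and [f_4] are linear in [al], [x]
    and [y], up to constants: this follows from product formulas and from the
    Wronskian of [phi(q)] and [phi(-q)], a sum over [Z^2] that factors after
    a rotation by 45 degrees ([wronskian]). To make [al] explicit, observe
    that [f_1^3] and [f_4^3], as signed sums of terms [t q^((t^2 - 1) / 8)]
    up to dilation, are fixed by the cube of a shift of [D], because [t^7 =
    t]. Comparing these two third order equations gives a formula for [D al],
    and then a cubic form in [x] and [y] that equals 1, the Hasse invariant
    of the Legendre family of elliptic curves ([hasse1]). Its derivative
    vanishes, which makes [al] a polynomial in [x] and [y] ([al_hasse]). The
    computation of [(D - 2)^6 h] takes place in a polynomial ring
    ([iter6_shifted_D]), and the result is [h - q^2 g^7].

    The product formulas all come from Jacobi's triple product, obtained as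
    the limit of a finite identity for Gaussian binomials; its derivative at
    [z = -1] gives the series for [f_1^3], and a rotation of norm 3 in
    [Z[sqrt(-2)]] turns the product of the series of [f_1^3] and [phi(-q)]
    into the one of [chi] and [f_2] ([dcube_phim]). *)

(** * Formal power series *)

Record fps (K : fieldType) := Fps { coef :> nat -> K }.

HB.instance Definition _ (K : fieldType) := gen_eqMixin (fps K).
HB.instance Definition _ (K : fieldType) := gen_choiceMixin (fps K).

Section Fps.
Variable K : fieldType.
Implicit Types (u v w : fps K) (n m : nat).

Lemma fpsP u v : (forall n, u n = v n) -> u = v.
Proof. by case: u v => u [v] /= /funext ->. Qed.

Definition fps_add u v := Fps (fun n => u n + v n).
Definition fps_opp u := Fps (fun n => - u n).
Definition fps_zero := Fps (fun=> 0 : K).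

Lemma fps_addA : associative fps_add.
Proof. by move=> u v w; apply: fpsP => n /=; rewrite addrA. Qed.
Lemma fps_addC : commutative fps_add.
Proof. by move=> u v; apply: fpsP => n /=; rewrite addrC. Qed.
Lemma fps_add0 : left_id fps_zero fps_add.
Proof. by move=> u; apply: fpsP => n /=; rewrite add0r. Qed.
Lemma fps_addN : left_inverse fps_zero fps_opp fps_add.
Proof. by move=> u; apply: fpsP => n /=; rewrite addNr. Qed.

HB.instance Definition _ :=
  GRing.isZmodule.Build (fps K) fps_addA fps_addC fps_add0 fps_addN.

Definition fps_const (c : K) := Fps (fun n => if n == 0%N then c else 0).
Definition fps_mul u v := Fps (fun n => \sum_(i < n.+1) u i * v (n - i)%N).

Definition poly_below N u : {poly K} := \poly_(i < N) u i.

Lemma coef_poly_below_mul N u v n : (n < N)%N ->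
  (poly_below N u * poly_below N v)`_n = fps_mul u v n.
Proof.
move=> nN; rewrite coefM /=; apply: eq_bigr => i _.
by rewrite !coef_poly !ifT //; have := ltn_ord i; lia.
Qed.

Lemma fps_mulA : associative fps_mul.
Proof.
move=> u v w; apply: fpsP => n.
pose p := poly_below n.+1.
transitivity ((p u * (p v * p w))`_n); last rewrite mulrA.
  rewrite coefM; apply: eq_bigr => i _; rewrite coef_poly ltn_ord.
  by rewrite coef_poly_below_mul //; lia.
rewrite coefM; apply: eq_bigr => i _.
by rewrite coef_poly_below_mul // coef_poly ifT //; lia.
Qed.

Lemma fps_mulC : commutative fps_mul.
Proof.
by move=> u v; apply: fpsP => n; rewrite -!(@coef_poly_below_mul n.+1) // mulrC.
Qed.

Lemma fps_mul1 : left_id (fps_const 1) fps_mul.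
Proof.
move=> u; apply: fpsP => n /=.
by rewrite big_ord_recl /= mul1r subn0 big1 ?addr0 // => i _; rewrite mul0r.
Qed.

Lemma fps_mulDl : left_distributive fps_mul fps_add.
Proof.
move=> u v w; apply: fpsP => n /=; rewrite -big_split /=.
by apply: eq_bigr => i _; rewrite mulrDl.
Qed.

Lemma fps_1neq0 : fps_const 1 != 0.
Proof. by apply/eqP => /(congr1 (fun u : fps K => u 0%N)) /eqP; rewrite oner_eq0. Qed.

HB.instance Definition _ := GRing.Zmodule_isComNzRing.Build (fps K)
  fps_mulA fps_mulC fps_mul1 fps_mulDl fps_1neq0.

Lemma fpsDE u v n : (u + v) n = u n + v n. Proof. by []. Qed.
Lemma fpsNE u n : (- u) n = - u n. Proof. by []. Qed.
Lemma fpsBE u v n : (u - v) n = u n - v n. Proof. by []. Qed.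
Lemma fps0E n : (0 : fps K) n = 0. Proof. by []. Qed.
Lemma fps1E n : (1 : fps K) n = (n == 0%N)%:R.
Proof. by rewrite /=; case: eqP. Qed.
Lemma fpsME u v n : (u * v) n = \sum_(i < n.+1) u i * v (n - i)%N.
Proof. by []. Qed.
Lemma fpsM0E u v : (u * v) 0%N = u 0%N * v 0%N.
Proof. by rewrite fpsME big_ord1. Qed.

Lemma fps_sumE I (r : seq I) (P : pred I) (F : I -> fps K) n :
  (\sum_(i <- r | P i) F i) n = \sum_(i <- r | P i) F i n.
Proof. by apply: (big_morph (fun u : fps K => u n)). Qed.

Lemma fpsMnE u m n : (u *+ m) n = u n *+ m.
Proof. by elim: m => // m IH; rewrite !mulrS fpsDE IH. Qed.

Lemma fps_const_is_additive : zmod_morphism fps_const.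
Proof. by move=> c d; apply: fpsP => n /=; case: ifP; rewrite ?subr0. Qed.
Lemma fps_const_is_multiplicative : monoid_morphism fps_const.
Proof.
split=> // c d; apply: fpsP => n; rewrite fpsME big_ord_recl big1 ?addr0 /=.
  by rewrite subn0; case: ifP => //; rewrite mulr0.
by move=> i _; rewrite mul0r.
Qed.
HB.instance Definition _ :=
  GRing.isZmodMorphism.Build K (fps K) fps_const fps_const_is_additive.
HB.instance Definition _ :=
  GRing.isMonoidMorphism.Build K (fps K) fps_const fps_const_is_multiplicative.

Lemma fps_constME c u n : (fps_const c * u) n = c * u n.
Proof.
by rewrite fpsME big_ord_recl /= subn0 big1 ?addr0 // => i _; rewrite mul0r.
Qed.

Definition fps_X m : fps K := Fps (fun n => (n == m)%:R).
Local Notation "''q^' m" := (fps_X m) (at level 8, m at level 2, format "''q^' m").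

Lemma fps_qE m n : 'q^m n = (n == m)%:R. Proof. by []. Qed.

Lemma fpsXME m u n : ('q^m * u) n = if (m <= n)%N then u (n - m)%N else 0.
Proof.
rewrite fpsME; case: leqP => mn.
  rewrite (bigD1 (Ordinal (mn : (m < n.+1)%N))) //= eqxx mul1r big1 ?addr0 //.
  by move=> i /negbTE; rewrite -val_eqE /= => ->; rewrite mul0r.
rewrite big1 // => i _ /=; case: eqP => [im|_]; last by rewrite mul0r.
by have := ltn_ord i; lia.
Qed.

Lemma fps_X0 : 'q^0 = 1.
Proof. by apply: fpsP => n; rewrite fps1E. Qed.

Lemma fps_XD m n : 'q^(m + n) = 'q^m * 'q^n.
Proof.
apply: fpsP => k; rewrite fpsXME /=; case: leqP => // [mk|km].
  by congr (_%:R); congr nat_of_bool; lia.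
by case: eqP => // e; lia.
Qed.

Lemma fps_X_exp m k : 'q^m ^+ k = 'q^(m * k).
Proof.
by elim: k => [|k IH]; rewrite ?muln0 ?fps_X0 // exprS IH mulnS fps_XD.
Qed.

Lemma fps_X_neq0 m : 'q^m != 0.
Proof.
apply/eqP => /(congr1 (fun u : fps K => u m)) /eqP.
by rewrite /= eqxx oner_eq0.
Qed.

Definition eqmod N u v := forall n, (n < N)%N -> u n = v n.

Lemma eqmod_sym N u v : eqmod N u v -> eqmod N v u.
Proof. by move=> e n /e. Qed.
Lemma eqmod_trans N v u w : eqmod N u v -> eqmod N v w -> eqmod N u w.
Proof. by move=> e1 e2 n nN; rewrite e1 ?e2. Qed.
Lemma eqmod_le N M u v : (N <= M)%N -> eqmod M u v -> eqmod N u v.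
Proof. by move=> NM e n nN; apply: e; apply: leq_trans NM. Qed.
Lemma eqmodD N u v u' v' :
  eqmod N u v -> eqmod N u' v' -> eqmod N (u + u') (v + v').
Proof. by move=> e1 e2 n nN; rewrite !fpsDE e1 ?e2. Qed.
Lemma eqmodM N u v u' v' :
  eqmod N u v -> eqmod N u' v' -> eqmod N (u * u') (v * v').
Proof.
move=> e1 e2 n nN; rewrite !fpsME; apply: eq_bigr => i _.
by rewrite e1 ?e2 //; have := ltn_ord i; lia.
Qed.
Lemma eqmodX N u v k : eqmod N u v -> eqmod N (u ^+ k) (v ^+ k).
Proof. by move=> e; elim: k => // k IH; rewrite !exprS; apply: eqmodM. Qed.
Lemma eqmod_sum N I (r : seq I) (P : pred I) (F G : I -> fps K) :
  (forall i, P i -> eqmod N (F i) (G i)) ->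
  eqmod N (\sum_(i <- r | P i) F i) (\sum_(i <- r | P i) G i).
Proof. by move=> e n nN; rewrite !fps_sumE; apply: eq_bigr => i /e; apply. Qed.
Lemma eqmod_prod N I (r : seq I) (P : pred I) (F G : I -> fps K) :
  (forall i, P i -> eqmod N (F i) (G i)) ->
  eqmod N (\prod_(i <- r | P i) F i) (\prod_(i <- r | P i) G i).
Proof.
by move=> e; apply: (big_ind2 (eqmod N)) => // u v u' v'; apply: eqmodM.
Qed.
Lemma eqmodP u v : (forall N, eqmod N u v) -> u = v.
Proof. by move=> e; apply: fpsP => n; apply: (e n.+1). Qed.

Lemma eqmod_X0 N m u : (N <= m)%N -> eqmod N ('q^m * u) 0.
Proof. by move=> Nm n nN; rewrite fpsXME leqNgt (leq_trans nN Nm). Qed.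

Lemma eqmod_expr0 u N : u 0%N = 0 -> eqmod N (u ^+ N) 0.
Proof.
move=> u0; elim: N => // N IH n nN; rewrite exprS fpsME big1 // => i _.
case: (posnP i) => [->|i0]; first by rewrite u0 mul0r.
by rewrite IH ?mulr0 //; have := ltn_ord i; lia.
Qed.

(** The limit of a sequence of series whose [n]-th term is already correct
    modulo [q^n]. *)
Definition fps_lim (F : nat -> fps K) := Fps (fun n => F n.+1 n).

Lemma fps_lim_eqmod F N : (forall n, eqmod n (F n.+1) (F n)) ->
  eqmod N (fps_lim F) (F N).
Proof.
move=> stab n nN; have [k ->] : exists k, N = (n.+1 + k)%N.
  by exists (N - n.+1)%N; lia.
elim: k {N nN} => [|k IH]; first by rewrite addn0.
by rewrite IH addnS stab //; lia.
Qed.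

End Fps.

Local Notation "''q^' m" := (fps_X _ m) (at level 8, m at level 2, format "''q^' m").

Section FpsUnit.
Variable K : fieldType.
Implicit Types (u v w : fps K) (n m : nat).

(** The partial sums of the geometric series for the inverse of [u / u(0)]. *)
Definition fps_geom u n := \sum_(k < n) (1 - fps_const (u 0%N)^-1 * u) ^+ k.
Definition fps_inv u :=
  if u 0%N == 0 then u else fps_const (u 0%N)^-1 * fps_lim (fps_geom u).

Lemma fps_geom_stable u n : u 0%N != 0 -> eqmod n (fps_geom u n.+1) (fps_geom u n).
Proof.
move=> u0; rewrite /fps_geom big_ord_recr /= -[X in eqmod n _ X]addr0.
by apply: eqmodD => //; apply: eqmod_expr0; rewrite fpsBE fps_constME mulVf ?subrr.
Qed.

Lemma fps_mulVr u : u 0%N != 0 -> fps_inv u * u = 1.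
Proof.
move=> u0; rewrite /fps_inv (negbTE u0); apply: eqmodP => N.
set c := fps_const _; set w := 1 - c * u.
have -> : c * fps_lim (fps_geom u) * u = (1 - w) * fps_lim (fps_geom u).
  by rewrite /w; ring.
apply: (@eqmod_trans _ _ ((1 - w) * fps_geom u N)).
  by apply: eqmodM => //; apply: fps_lim_eqmod => n; apply: fps_geom_stable.
have -> : (1 - w) * fps_geom u N = 1 - w ^+ N.
  by rewrite -[1 - w]opprB mulNr -subrX1 opprB.
move=> n nN; rewrite fpsBE (eqmod_expr0 _ nN) ?fps0E ?subr0 //.
by rewrite fpsBE fps_constME mulVf ?subrr.
Qed.

Definition fps_unit : {pred fps K} := [pred u : fps K | u 0%N != 0].

Lemma fps_unitP u v : v * u = 1 -> u \in fps_unit.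
Proof.
move=> /(congr1 (fun u : fps K => u 0%N)); rewrite fpsM0E /= => e.
by apply/eqP => u0; move: e; rewrite u0 mulr0 => /esym/eqP; rewrite oner_eq0.
Qed.

Lemma fps_inv_out : {in [predC fps_unit], fps_inv =1 id}.
Proof. by move=> u; rewrite !inE negbK /fps_inv => ->. Qed.

HB.instance Definition _ := GRing.ComNzRing_hasMulInverse.Build (fps K)
  fps_mulVr fps_unitP fps_inv_out.

Lemma fps_unitE u : (u \is a GRing.unit) = (u 0%N != 0). Proof. by []. Qed.

Lemma fps_factor u : u != 0 -> exists m v, v 0%N != 0 /\ u = 'q^m * v.
Proof.
move=> u0; have [n un] : exists n, u n != 0.
  apply: contrapT => h; move/eqP: u0; apply; apply: fpsP => n.
  by apply/eqP; apply: contrapT => un; apply: h; exists n; apply/negP.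
case: (ex_minnP (ex_intro (fun n => u n != 0) n un)) => m um mmin.
exists m, (Fps (fun k => u (k + m)%N)); split; first by rewrite /= add0n.
apply: fpsP => k; rewrite fpsXME /=; case: leqP => mk; first by rewrite subnK.
by apply/eqP; apply: contraLR mk => uk; rewrite -leqNgt mmin.
Qed.

Lemma fps_integral u v : u * v = 0 -> (u == 0) || (v == 0).
Proof.
move=> uv; apply/norP => -[/fps_factor[m [u' [u0 eu]]] /fps_factor[n [v' [v0 ev]]]].
move: uv; rewrite eu ev mulrACA -fps_XD.
move=> /(congr1 (fun u : fps K => u (m + n)%N)).
rewrite fpsXME leqnn subnn fpsM0E => /eqP.
by rewrite mulf_eq0 (negbTE u0) (negbTE v0).
Qed.

HB.instance Definition _ :=
  GRing.ComUnitRing_isIntegral.Build (fps K) fps_integral.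

End FpsUnit.

Section FpsOperators.
Variable K : fieldType.
Implicit Types (u v w : fps K) (n m : nat).

(** The derivation [q d/dq], for which [q^n] is an eigenvector. *)
Definition fps_D u := Fps (fun n => n%:R * u n).

Lemma fps_D_is_additive : zmod_morphism fps_D.
Proof. by move=> u v; apply: fpsP => n /=; rewrite mulrBr. Qed.
HB.instance Definition _ :=
  GRing.isZmodMorphism.Build (fps K) (fps K) fps_D fps_D_is_additive.

Lemma fps_DM u v : fps_D (u * v) = fps_D u * v + u * fps_D v.
Proof.
apply: fpsP => n; rewrite fpsDE !fpsME /= mulr_sumr -big_split /=.
apply: eq_bigr => i _; rewrite -{1}(subnKC (ltn_ord i : (i <= n)%N)) natrD.
by ring.
Qed.

Lemma fps_DX u n : fps_D (u ^+ n.+1) = n.+1%:R * u ^+ n * fps_D u.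
Proof.
elim: n => [|n IH]; first by rewrite expr0 expr1; ring.
by rewrite exprS fps_DM IH -[n.+2%:R]natr1 !exprS; ring.
Qed.

Lemma fps_D_q m : fps_D 'q^m = m%:R * 'q^m.
Proof.
apply: fpsP => n; rewrite mulr_natl fpsMnE /=.
by case: eqP => [->|_]; rewrite ?mulr1 // mulr0 mul0rn.
Qed.

Lemma fps_D_const c : fps_D (fps_const c) = 0.
Proof.
by apply: fpsP => -[|n] /=; rewrite ?mul0r // mulr0.
Qed.

Lemma fps_D1 : fps_D 1 = 0. Proof. exact: fps_D_const. Qed.

Lemma fps_D_nat m : fps_D m%:R = 0.
Proof. by rewrite raddfMn /= fps_D1 mul0rn. Qed.

(** Substitution of [q^m] for [q]. *)
Definition fps_dil m u := Fps (fun n => if (m %| n)%N then u (n %/ m)%N else 0).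

Lemma fps_dilE m u n :
  fps_dil m u n = if (m %| n)%N then u (n %/ m)%N else 0.
Proof. by []. Qed.

(** For a prime [m] and [r = 0] this is the operator [U_m] of Atkin. *)
Definition fps_sec m r u := Fps (fun n => u (m * n + r)%N).

Lemma fps_dil_is_additive m : zmod_morphism (fps_dil m).
Proof. by move=> u v; apply: fpsP => n /=; case: ifP; rewrite ?subr0. Qed.
HB.instance Definition _ m :=
  GRing.isZmodMorphism.Build (fps K) (fps K) (fps_dil m) (fps_dil_is_additive m).

Lemma fps_sec_is_additive m r : zmod_morphism (fps_sec m r).
Proof. by move=> u v; apply: fpsP => n. Qed.
HB.instance Definition _ m r :=
  GRing.isZmodMorphism.Build (fps K) (fps K) (fps_sec m r) (fps_sec_is_additive m r).

Lemma fps_ext_sec m u v : (0 < m)%N ->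
  (forall r, (r < m)%N -> fps_sec m r u = fps_sec m r v) -> u = v.
Proof.
move=> m0 e; apply: fpsP => n; rewrite (divn_eq n m) mulnC.
by have /(congr1 (fun w : fps K => w (n %/ m)%N)) := e _ (ltn_pmod n m0).
Qed.

(** Terms indexed by non multiples of [m] are absent from a product with a
    series in [q^m]; the bound [m n + r] is the one met in such a product. *)
Lemma sum_multiples m r n (F : nat -> K) : (r < m)%N ->
  (forall i, ~~ (m %| i)%N -> F i = 0) ->
  \sum_(i < (m * n + r).+1) F i = \sum_(j < n.+1) F (m * j)%N.
Proof.
move=> rm F0; have gap a k : (k < m)%N ->
    \sum_((m * a).+1 <= i < (m * a + k).+1) F i = 0.
  move=> km; rewrite big_nat big1 // => i ik; apply: F0.
  apply/negP => /dvdnP[c ec]; have : (m * a < m * c)%N by lia.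
  have : (m * c < m * a.+1)%N by lia.
  by rewrite !ltn_mul2l; lia.
elim: n r rm => [|n IH] r rm.
  rewrite big_ord1 -(big_mkord xpredT F) big_ltn // muln0 add0n.
  by have := gap 0%N r rm; rewrite muln0 add0n => ->; rewrite addr0.
have m1 : (m.-1 < m)%N by lia.
rewrite [RHS]big_ord_recr /= -(IH _ m1).
have -> : (m * n + m.-1).+1 = (m * n.+1)%N by lia.
rewrite -!(big_mkord xpredT F) (@big_cat_nat _ _ _ (m * n.+1)) //=; last by lia.
rewrite [X in _ + X]big_ltn; last by lia.
by rewrite gap // addr0.
Qed.

Lemma fps_sec_dilM m r u v : (r < m)%N ->
  fps_sec m r (fps_dil m u * v) = u * fps_sec m r v.
Proof.
move=> rm; apply: fpsP => n; rewrite [RHS]fpsME [LHS](fpsME _ _ (m * n + r)).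
pose F i := fps_dil m u i * v (m * n + r - i)%N.
rewrite (_ : \sum_(i < _) _ = \sum_(i < (m * n + r).+1) F i) //.
rewrite sum_multiples //; last by move=> i /negbTE mi; rewrite /F /= mi mul0r.
apply: eq_bigr => j _; rewrite /F /= dvdn_mulr // mulKn; last by lia.
by congr (_ * v _); have := ltn_ord j; nia.
Qed.

Lemma fps_sec_dil m r u : (r < m)%N ->
  fps_sec m r (fps_dil m u) = if r == 0%N then u else 0.
Proof.
move=> rm; rewrite -[fps_dil m u]mulr1 fps_sec_dilM //.
case: eqP => [->|r0].
  rewrite -[RHS]mulr1; congr (_ * _); apply: fpsP => n.
  by rewrite fps1E [LHS](fps1E _ (m * n + 0)); congr (_%:R); congr nat_of_bool; nia.
rewrite (_ : fps_sec _ _ _ = 0) ?mulr0 //; apply: fpsP => n.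
by rewrite [LHS](fps1E _ (m * n + r)) (_ : (_ == _) = false) //; lia.
Qed.

Lemma fps_dil1 m : (0 < m)%N -> fps_dil m 1 = 1.
Proof.
move=> m0; apply: fpsP => n; rewrite fps_dilE [RHS]fps1E.
case: ifP => [/dvdnP[k ->]|h].
  by rewrite mulnK // fps1E muln_eq0; congr (_%:R); lia.
by case: n h => // /negP; rewrite dvdn0.
Qed.

Lemma fps_dilM m u v : (0 < m)%N ->
  fps_dil m (u * v) = fps_dil m u * fps_dil m v.
Proof.
move=> m0; apply: (fps_ext_sec m0) => r rm.
by rewrite fps_sec_dilM // !fps_sec_dil //; case: eqP; rewrite ?mulr0.
Qed.

Lemma fps_dil_nat m k : (0 < m)%N -> fps_dil m k%:R = k%:R.
Proof.
move=> m0; elim: k => [|k IH]; first exact: raddf0.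
by rewrite -[k.+1%:R]natr1 raddfD /= IH fps_dil1.
Qed.

Lemma fps_dilX m u k : (0 < m)%N -> fps_dil m (u ^+ k) = fps_dil m u ^+ k.
Proof.
by move=> m0; elim: k => [|k IH]; rewrite ?fps_dil1 // !exprS fps_dilM // IH.
Qed.

Lemma fps_dil_prod m I (r : seq I) (F : I -> fps K) : (0 < m)%N ->
  fps_dil m (\prod_(i <- r) F i) = \prod_(i <- r) fps_dil m (F i).
Proof.
move=> m0; apply: (big_morph (fps_dil m)); last exact: fps_dil1.
by move=> u v; apply: fps_dilM.
Qed.

Lemma fps_dil_q m k : (0 < m)%N -> fps_dil m 'q^k = 'q^(m * k).
Proof.
move=> m0; apply: fpsP => n /=; case: ifP => [/dvdnP[j ->]|h].
  by rewrite mulnK // mulnC eqn_mul2l; congr (_%:R); lia.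
by case: eqP => // e; rewrite e dvdn_mulr in h.
Qed.

Lemma fps_dil_dil m k u : (0 < m)%N -> (0 < k)%N ->
  fps_dil m (fps_dil k u) = fps_dil (m * k) u.
Proof.
move=> m0 k0; apply: fpsP => n /=; case: ifP => [/dvdnP[j ->]|h].
  by rewrite mulnK // [(j * m)%N]mulnC dvdn_pmul2l // divnMl.
by case: ifP => // /dvdnP[j e]; rewrite e mulnCA dvdn_mulr in h.
Qed.

(** Substitution of [-q] for [q]. *)
Definition fps_alt u := Fps (fun n => (-1) ^+ n * u n).

Lemma fps_altE u n : fps_alt u n = (-1) ^+ n * u n. Proof. by []. Qed.

Lemma fps_alt_is_additive : zmod_morphism fps_alt.
Proof. by move=> u v; apply: fpsP => n /=; rewrite mulrBr. Qed.
HB.instance Definition _ :=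
  GRing.isZmodMorphism.Build (fps K) (fps K) fps_alt fps_alt_is_additive.

Lemma fps_alt_is_multiplicative : monoid_morphism fps_alt.
Proof.
split; first by apply: fpsP => -[|n] /=; rewrite ?mulr1 ?mulr0.
move=> u v; apply: fpsP => n; rewrite fps_altE !fpsME mulr_sumr.
apply: eq_bigr => i _ /=.
by rewrite -{1}(subnKC (ltn_ord i : (i <= n)%N)) exprD; ring.
Qed.
HB.instance Definition _ :=
  GRing.isMonoidMorphism.Build (fps K) (fps K) fps_alt fps_alt_is_multiplicative.

Lemma fps_alt_q m : fps_alt 'q^m = (-1) ^+ m * 'q^m.
Proof.
apply: fpsP => n; rewrite -(rmorphN1 (@fps_const K)) -rmorphXn fps_constME /=.
by case: eqP => [->|]; rewrite ?mulr0.
Qed.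

(** In characteristic [p] the Frobenius map of [K[[q]]] is [q -> q^p] on series
    with coefficients in the prime field; congruence modulo [q^N] reduces this
    to the additivity of the Frobenius map on finite sums. *)
Lemma fps_frobenius p u : p \in [pchar K] -> (forall n, u n ^+ p = u n) ->
  u ^+ p = fps_dil p u.
Proof.
move=> pK up; have p0 : (0 < p)%N by rewrite prime_gt0 // (pcharf_prime pK).
have pF : p \in [pchar (fps K)].
  rewrite inE (pcharf_prime pK) /=; apply/eqP.
  by rewrite -(rmorph_nat (@fps_const K)) (pcharf0 pK) rmorph0.
apply: eqmodP => N; pose t := \sum_(i < N) fps_const (u i) * 'q^i.
have tu : eqmod N u t.
  move=> n nN; rewrite fps_sumE (bigD1 (Ordinal nN)) // fps_constME fps_qE eqxx mulr1.
  rewrite big1 => [|i /negbTE ni]; first by rewrite /= addr0.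
  by rewrite fps_constME fps_qE eq_sym (ni : (val i == n) = false) mulr0.
apply: (@eqmod_trans _ _ (t ^+ p)); first exact: eqmodX.
have -> : t ^+ p = fps_dil p t.
  rewrite -(pFrobenius_autE pF) !raddf_sum /=; apply: eq_bigr => i _.
  rewrite fps_dilM // fps_dil_q // pFrobenius_autE exprMn fps_X_exp mulnC.
  congr (_ * _); rewrite -rmorphXn up; apply: fpsP => n.
  rewrite fps_dilE /=; case: (boolP (p %| n)%N) => [/dvdnP[j ->]|].
    by rewrite mulnK // muln_eq0 (gtn_eqF p0) orbF.
  by case: n => //; rewrite dvdn0.
apply: eqmod_sym => n nN; rewrite !fps_dilE; case: ifP => // _.
by apply: tu; apply: leq_ltn_trans nN; apply: leq_div.
Qed.

End FpsOperators.

(** * Series indexed by a lattice *)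

(** The sums over infinite index sets used below are 0 by convention when their
    support is infinite; [proper] excludes this for every coefficient. *)
Definition proper (I : choiceType) (e : I -> nat) :=
  forall n, exists r : seq I, forall i, (e i <= n)%N -> i \in r.

(** The series [sum_i w(i) q^(e(i))], for [e] as in [proper]. *)
Definition wsum (K : fieldType) (I : choiceType) (w : I -> K) (e : I -> nat) :
  fps K := Fps (fun n => \sum_(i \in [set i | e i = n]) w i).

Section Wsum.
Variable K : fieldType.
Implicit Types I J : choiceType.

Lemma proper_uniq I (e : I -> nat) n : proper e ->
  exists2 r : seq I, uniq r & forall i, (e i <= n)%N -> i \in r.
Proof.
move=> /(_ n)[r re]; exists (undup r); first exact: undup_uniq.
by move=> i; rewrite mem_undup; apply: re.
Qed.

Lemma proper_inj I J (e : I -> nat) (g : J -> I) (h : I -> J) :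
  cancel g h -> proper e -> proper (e \o g).
Proof.
move=> gK pe n; have [r re] := pe n; exists (map h r) => j /= /re jr.
by rewrite -(gK j) map_f.
Qed.

Lemma proper_pair I J (e : I -> nat) (e' : J -> nat) :
  proper e -> proper e' -> proper (fun p : I * J => e p.1 + e' p.2)%N.
Proof.
move=> pe pe' n; have [r re] := pe n; have [s se] := pe' n.
exists [seq (i, j) | i <- r, j <- s] => -[i j] /= ij.
by apply/allpairsP; exists (i, j); split=> //=; [apply: re|apply: se]; lia.
Qed.

Lemma proper_mul I (e : I -> nat) m : (0 < m)%N -> proper e ->
  proper (fun i => m * e i)%N.
Proof. by move=> m0 pe n; have [r re] := pe n; exists r => i h; apply: re; nia. Qed.

Lemma proper_int (e : int -> nat) :
  (forall k, `|k| <= (e k).+1)%N -> proper e.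
Proof.
move=> ek n; exists [seq i%:Z - n.+1%:Z | i <- iota 0 (2 * n + 3)] => k kn.
apply/mapP; exists (absz (k + n.+1%:Z)); last by have := ek k; lia.
by rewrite mem_iota; have := ek k; lia.
Qed.

Lemma wsumE I (w : I -> K) e n (r : seq I) : uniq r ->
  (forall i, e i = n -> i \in r) -> wsum w e n = \sum_(i <- r | e i == n) w i.
Proof.
move=> ur er; rewrite /= -[RHS]big_filter (fsbigE [seq i <- r | e i == n]).
- rewrite big_seq_cond [RHS]big_seq; apply: eq_bigl => i.
  rewrite mem_filter; case: eqP => //= ei.
  by rewrite (_ : (i \in [set i | e i = n]) = true) ?andbT //; apply/mem_set.
- exact: filter_uniq.
- by move=> i /=; rewrite mem_filter => /andP[/eqP].
- by move=> i /= ei; rewrite mem_filter ei eqxx er.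
Qed.

Lemma eq_wsum I (w w' : I -> K) (e e' : I -> nat) :
  w =1 w' -> e =1 e' -> wsum w e = wsum w' e'.
Proof. by move=> /funext -> /funext ->. Qed.

Lemma wsum_supp I (w : I -> K) e n : wsum w e n != 0 -> exists i, e i = n.
Proof.
move=> h; apply: contrapT => nex; move/eqP: h; apply.
by apply: fsbig1 => i ei; case: nex; exists i.
Qed.

Lemma wsumD I (w w' : I -> K) e : proper e ->
  wsum (fun i => w i + w' i) e = wsum w e + wsum w' e.
Proof.
move=> pe; apply: fpsP => n; have [r ur re] := proper_uniq n pe.
have re' i : e i = n -> i \in r by move=> ei; apply: re; rewrite ei.
by rewrite fpsDE !(wsumE _ ur re') big_split.
Qed.

Lemma wsumZ I c (w : I -> K) e :
  wsum (fun i => c * w i) e = fps_const c * wsum w e.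
Proof. by apply: fpsP => n; rewrite fps_constME [RHS]mulr_fsumr. Qed.

Lemma wsumN I (w : I -> K) e : wsum (fun i => - w i) e = - wsum w e.
Proof.
rewrite -mulN1r -(rmorphN1 (@fps_const K)) -wsumZ.
by apply: eq_wsum => // i; rewrite mulN1r.
Qed.

Lemma wsum_D I (w : I -> K) e :
  fps_D (wsum w e) = wsum (fun i => (e i)%:R * w i) e.
Proof.
apply: fpsP => n /=; rewrite mulr_fsumr; apply: eq_fsbigr => i.
by rewrite in_setE /= => ->.
Qed.

Lemma wsum_dil I m (w : I -> K) e : (0 < m)%N ->
  fps_dil m (wsum w e) = wsum w (fun i => m * e i)%N.
Proof.
move=> m0; apply: fpsP => n; rewrite fps_dilE; case: ifP => [/dvdnP[k ->]|h] /=.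
  rewrite mulnK //; apply: eq_fsbigl; apply/seteqP; split=> i /= ei.
    by rewrite ei mulnC.
  by apply/eqP; rewrite -(eqn_pmul2l m0) ei mulnC.
by rewrite fsbig1 // => i /= ei; rewrite -ei dvdn_mulr in h.
Qed.

Lemma wsum_q I m (w : I -> K) e :
  'q^m * wsum w e = wsum w (fun i => m + e i)%N.
Proof.
apply: fpsP => n; rewrite fpsXME; case: leqP => mn /=.
  by apply: eq_fsbigl; apply/seteqP; split=> i /= ei; lia.
by rewrite fsbig1 // => i /= ei; lia.
Qed.

Lemma wsum_reindex I J (g : J -> I) (h : I -> J) (w : I -> K) e :
  cancel g h -> cancel h g -> wsum w e = wsum (w \o g) (e \o g).
Proof.
move=> gK hK; apply: fpsP => n /=; apply: reindex_fsbig.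
split=> [j //|i j _ _ /(can_inj gK) //|i /= ei].
by exists (h i); rewrite /= hK.
Qed.

Lemma wsum_sum I J (w : I + J -> K) e : proper e ->
  wsum w e = wsum (w \o inl) (e \o inl) + wsum (w \o inr) (e \o inr).
Proof.
move=> pe; apply: fpsP => n; have [r ur re] := proper_uniq n pe.
have pl : proper (e \o inl : I -> nat).
  move=> m; have [s se] := pe m.
  exists (pmap (fun x => if x is inl i then Some i else None) s) => i /= /se si.
  by rewrite mem_pmap; apply/mapP; exists (inl i).
have pr : proper (e \o inr : J -> nat).
  move=> m; have [s se] := pe m.
  exists (pmap (fun x => if x is inr i then Some i else None) s) => i /= /se si.
  by rewrite mem_pmap; apply/mapP; exists (inr i).
have [r1 u1 re1] := proper_uniq n pl; have [r2 u2 re2] := proper_uniq n pr.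
have r1E i : e (inl i) = n -> i \in r1 by move=> ei; apply: re1; rewrite /= ei.
have r2E i : e (inr i) = n -> i \in r2 by move=> ei; apply: re2; rewrite /= ei.
rewrite fpsDE (wsumE _ u1 r1E) (wsumE _ u2 r2E).
rewrite (@wsumE _ w e n (map inl r1 ++ map inr r2)).
- by rewrite big_cat !big_map.
- rewrite cat_uniq !map_inj_uniq ?u1 ?u2 //=; try by move=> ? ? [].
  by rewrite andbT; apply/hasPn => _ /mapP[j _ ->]; apply/negP => /mapP[].
- case=> [i|j] ei; rewrite mem_cat; apply/orP; [left|right]; apply: map_f.
    exact: r1E.
  exact: r2E.
Qed.

Lemma wsumM I J (w : I -> K) e (w' : J -> K) e' : proper e -> proper e' ->
  wsum w e * wsum w' e' =
  wsum (fun p : I * J => w p.1 * w' p.2) (fun p => e p.1 + e' p.2)%N.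
Proof.
move=> pe pe'; apply: fpsP => n.
have [r ur re] := proper_uniq n pe; have [s us se] := proper_uniq n pe'.
rewrite (@wsumE _ _ _ _ [seq (i, j) | i <- r, j <- s]); first last.
- move=> [i j] /= ij; apply/allpairsP; exists (i, j).
  by split=> //=; [apply: re|apply: se]; lia.
- by apply: allpairs_uniq => // -[? ?] [? ?].
rewrite [RHS]big_mkcond big_allpairs fpsME.
transitivity (\sum_(a < n.+1) \sum_(i <- r) \sum_(j <- s)
    if (e i == a) && (e' j == n - a)%N then w i * w' j else 0).
  apply: eq_bigr => a _; rewrite (@wsumE _ w e a r) //; last first.
    by move=> i ei; apply: re; rewrite ei -ltnS.
  rewrite (@wsumE _ w' e' _ s) //; last by move=> j ej; apply: se; lia.
  rewrite big_mkcond mulr_suml; apply: eq_bigr => i _.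
  case: eqP => _; last by rewrite mul0r big1.
  rewrite big_mkcond mulr_sumr; apply: eq_bigr => j _.
  by rewrite andTb; case: ifP => // _; rewrite mulr0.
rewrite exchange_big; apply: eq_bigr => i _.
rewrite exchange_big; apply: eq_bigr => j _.
case: eqP => [/= en|/= nen].
  have ein : (e i < n.+1)%N by lia.
  rewrite (bigD1 (Ordinal ein)) //= eqxx (_ : (_ == _)%N) ?big1 ?addr0 //; last lia.
  move=> a /negbTE; rewrite -val_eqE /= eq_sym => ->; by [].
rewrite big1 // => a _; case: andP => // -[/eqP h1 /eqP h2].
by have := ltn_ord a; lia.
Qed.

(** The symmetry [s] pairs off terms with opposite signs, and fixed points of
    [s] have weight 0 since 2 is invertible. *)
Lemma wsum_odd I (s : I -> I) (w : I -> K) e : (2%:R : K) != 0 ->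
  involutive s -> (forall i, w (s i) = - w i) -> (forall i, e (s i) = e i) ->
  wsum w e = 0.
Proof.
move=> two0 sK ws es; have h : wsum w e = - wsum w e.
  rewrite {1}(wsum_reindex w e sK sK) -wsumN.
  by apply: eq_wsum => i /=; rewrite ?ws ?es.
apply: fpsP => n; apply/eqP; have /eqP := congr1 (fun u : fps K => u n) h.
by rewrite fpsNE -addr_eq0 -mulr2n -mulr_natr mulf_eq0 (negbTE two0) orbF.
Qed.

Lemma wsum_mulE I (w : I -> K) e (u : fps K) n : proper e ->
  (wsum w e * u) n =
  \sum_(i \in [set: I]) w i * (if (e i <= n)%N then u (n - e i)%N else 0).
Proof.
move=> pe; have [r ur re] := proper_uniq n pe.
rewrite (fsbigE r) //; last first.
  by move=> i _ ir; case: ifP => [/re|_]; rewrite ?mulr0 // (negbTE ir).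
transitivity (\sum_(a < n.+1) \sum_(i <- r)
    (if e i == a then w i else 0) * u (n - a)%N).
  rewrite fpsME; apply: eq_bigr => a _.
  rewrite (@wsumE _ w e a r) //; last first.
    by move=> i ei; apply: re; rewrite ei -ltnS.
  by rewrite big_mkcond mulr_suml.
rewrite exchange_big [RHS]big_mkcond /=; apply: eq_bigr => i _.
rewrite in_setT; case: leqP => ein.
  rewrite (bigD1 (Ordinal (ein : (e i < n.+1)%N))) //= eqxx big1 ?addr0 //.
  by move=> a /negbTE; rewrite -val_eqE /= eq_sym => ->; rewrite mul0r.
rewrite mulr0 big1 // => a _; case: eqP => [h|_]; last by rewrite mul0r.
by have := ltn_ord a; lia.
Qed.

End Wsum.

(** * Infinite products *)

Section InfiniteProducts.
Variable K : fieldType.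
Implicit Types (eps : K) (c M m N : nat).

Definition qfin eps c M n : fps K :=
  \prod_(i < n) (1 + fps_const eps * 'q^(c + M * i)).
(** The product of [1 + eps q^a] over the [a >= c] congruent to [c] modulo [M]. *)
Definition qprod eps c M : fps K := fps_lim (qfin eps c M).

Definition euler m := qprod (-1) m m.

Lemma eqmod_1DX eps N m : (N <= m)%N ->
  eqmod N (1 + fps_const eps * 'q^m : fps K) 1.
Proof.
move=> Nm; rewrite -[X in eqmod _ _ X]addr0 mulrC.
by apply: eqmodD => //; apply: eqmod_X0.
Qed.

Lemma qfin_stable eps c M n : (0 < M)%N ->
  eqmod n (qfin eps c M n.+1) (qfin eps c M n).
Proof.
move=> M0; rewrite /qfin big_ord_recr /= -[X in eqmod _ _ X]mulr1.
by apply: eqmodM => //; apply: eqmod_1DX; nia.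
Qed.

Lemma qprod_eqmod eps c M N n : (0 < M)%N -> (N <= n)%N ->
  eqmod N (qprod eps c M) (qfin eps c M n).
Proof.
move=> M0 Nn; apply: eqmod_le Nn _.
by apply: fps_lim_eqmod => k; apply: qfin_stable.
Qed.

Lemma qprod_unit eps c M : (0 < c)%N -> (0 < M)%N ->
  qprod eps c M \is a GRing.unit.
Proof.
move=> c0 M0; rewrite fps_unitE (@qprod_eqmod _ _ _ 1 1) //.
rewrite /qfin big_ord1 fpsDE fps1E fps_constME fps_qE muln0 addn0.
by case: c c0 => // c _; rewrite mulr0 addr0 oner_eq0.
Qed.

Lemma euler_unit m : (0 < m)%N -> euler m \is a GRing.unit.
Proof. by move=> m0; apply: qprod_unit. Qed.

Lemma qprod_rec eps c M : (0 < M)%N ->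
  qprod eps c M = (1 + fps_const eps * 'q^c) * qprod eps (c + M) M.
Proof.
move=> M0; apply: eqmodP => N.
apply: (eqmod_trans (qprod_eqmod eps c M0 (leqnSn N))).
rewrite /qfin big_ord_recl /= muln0 addn0; apply: eqmodM => //.
apply: eqmod_sym; apply: (eqmod_trans (qprod_eqmod eps _ M0 (leqnn N))).
move=> k _; congr (coef _ k); apply: eq_bigr => i _.
by congr (_ + _ * 'q^_); rewrite /bump /=; lia.
Qed.

Lemma prod_residues (F : nat -> fps K) k n :
  \prod_(i < n * k) F i = \prod_(j < k) \prod_(i < n) F (i * k + j)%N.
Proof.
elim: n => [|n IH].
  by rewrite big_ord0 big1 // => j _; rewrite big_ord0.
under [RHS]eq_bigr do rewrite big_ord_recr /=.
rewrite big_split /= -IH -!(big_mkord xpredT F).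
rewrite (@big_cat_nat _ _ _ (n * k)) //=; last by rewrite leq_mul2r leqnSn orbT.
congr (_ * _); rewrite -{1}[(n * k)%N]add0n big_addn.
rewrite mulSn addnK big_mkord; apply: eq_bigr => i _.
by rewrite addnC.
Qed.

Lemma qprod_residues eps c M k : (0 < M)%N -> (0 < k)%N ->
  qprod eps c M = \prod_(j < k) qprod eps (c + M * j) (k * M).
Proof.
move=> M0 k0; apply: eqmodP => N.
apply: (@eqmod_trans _ _ (qfin eps c M (N * k))).
  by apply: qprod_eqmod => //; rewrite leq_pmulr.
rewrite /qfin (prod_residues (fun i => 1 + fps_const eps * 'q^(c + M * i))).
apply: eqmod_sym; apply: eqmod_prod => j _.
apply: (@eqmod_trans _ _ (qfin eps (c + M * j) (k * M) N)).
  by apply: qprod_eqmod; rewrite // muln_gt0 k0.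
move=> n _; congr (coef _ n); apply: eq_bigr => i _.
by congr (_ + _ * 'q^_); nia.
Qed.

Lemma qprodMN eps c M : (0 < M)%N ->
  qprod eps c M * qprod (- eps) c M = qprod (- eps ^+ 2) (2 * c) (2 * M).
Proof.
move=> M0; apply: eqmodP => N.
apply: (@eqmod_trans _ _ (qfin eps c M N * qfin (- eps) c M N)).
  by apply: eqmodM; apply: qprod_eqmod.
apply: eqmod_sym; apply: (@eqmod_trans _ _ (qfin (- eps ^+ 2) (2 * c) (2 * M) N)).
  by apply: qprod_eqmod; rewrite // muln_gt0.
rewrite /qfin -big_split => k _; congr (coef _ k); apply: eq_bigr => i _.
rewrite -mulnA -mulnDr mulnC -fps_X_exp !rmorphN rmorphXn /=.
by rewrite -/((_ + _) * _); ring.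
Qed.

Lemma qprod_dil eps c M m : (0 < M)%N -> (0 < m)%N ->
  fps_dil m (qprod eps c M) = qprod eps (m * c) (m * M).
Proof.
move=> M0 m0; have mM0 : (0 < m * M)%N by rewrite muln_gt0 m0.
have fin n : fps_dil m (qfin eps c M n) = qfin eps (m * c) (m * M) n.
  rewrite /qfin fps_dil_prod //; apply: eq_bigr => i _.
  rewrite raddfD /= fps_dil1 // fps_dilM // fps_dil_q // -mulnA -mulnDr.
  congr (_ + _ * _); apply: fpsP => k; rewrite fps_dilE /=.
  case: (boolP (m %| k)%N) => [/dvdnP[j ->]|].
    by rewrite mulnK // muln_eq0 (gtn_eqF m0) orbF.
  by case: k => //; rewrite dvdn0.
apply: eqmodP => N; apply: eqmod_sym.
apply: (eqmod_trans (qprod_eqmod eps (m * c) mM0 (leqnn N))); rewrite -fin.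
move=> k kN; rewrite !fps_dilE; case: ifP => // _; apply: eqmod_sym.
  exact: qprod_eqmod (leqnn N).
by apply: leq_ltn_trans kN; apply: leq_div.
Qed.

Lemma qprod_alt eps c M : (0 < M)%N ->
  fps_alt (qprod eps c (2 * M)) = qprod ((-1) ^+ c * eps) c (2 * M).
Proof.
move=> M0; apply: fpsP => n.
transitivity (fps_alt (qfin eps c (2 * M) n.+1) n); first by [].
transitivity (qfin ((-1) ^+ c * eps) c (2 * M) n.+1 n); last by [].
rewrite /qfin rmorph_prod; congr (coef _ n); apply: eq_bigr => i _.
rewrite rmorphD rmorph1 rmorphM /= fps_alt_q exprD -mulnA exprM sqrrN !expr1n.
rewrite mulr1 rmorphM rmorphXn rmorphN1 mulrA /=; congr (_ + _ * _).
rewrite mulrC; congr (_ * _); apply: fpsP => -[|k] /=; rewrite ?mul1r ?mulr0 //.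
Qed.

End InfiniteProducts.

(** * The finite triple product identity *)

Section QBinomial.
Variable A : comNzRingType.
Variable Q : A.
Implicit Types (k m n l : nat) (z : A).

(** Gaussian binomial coefficients, by one of the two Pascal rules. *)
Fixpoint qbin n k : A :=
  match n, k with
  | _, 0 => 1
  | 0, _.+1 => 0
  | n'.+1, k'.+1 => qbin n' k' + Q ^+ k'.+1 * qbin n' k'.+1
  end.

Definition qfact n : A := \prod_(i < n) (1 - Q ^+ i.+1).

Lemma qbin0 n : qbin n 0 = 1. Proof. by case: n. Qed.

Lemma qbinSS n k : qbin n.+1 k.+1 = qbin n k + Q ^+ k.+1 * qbin n k.+1.
Proof. by []. Qed.

Lemma qbin_small n k : (n < k)%N -> qbin n k = 0.
Proof.
elim: n k => [|n IH] [|k] //= nk.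
by rewrite !IH ?mulr0 ?addr0 //; lia.
Qed.

Lemma qbinn n : qbin n n = 1.
Proof. by elim: n => //= n ->; rewrite qbin_small ?mulr0 ?addr0. Qed.

Lemma qbin_fact k l : qbin (k + l) k * (qfact k * qfact l) = qfact (k + l).
Proof.
elim: k l => [|k IHk] l; first by rewrite qbin0 /qfact big_ord0 !mul1r.
elim: l => [|l IHl]; first by rewrite addn0 qbinn /qfact big_ord0 mul1r mulr1.
have qS n : qfact n.+1 = qfact n * (1 - Q ^+ n.+1) by rewrite /qfact big_ord_recr.
have := IHk l.+1; move: IHl; rewrite addSnnS addSn /=.
set n := (k + l.+1)%N => e2 e1.
transitivity ((1 - Q ^+ k.+1) * (qbin n k * (qfact k * qfact l.+1)) +
   Q ^+ k.+1 * (1 - Q ^+ l.+1) * (qbin n k.+1 * (qfact k.+1 * qfact l))).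
  by rewrite (qS k) (qS l); ring.
rewrite e1 e2 (qS n) -[n.+1]/(k.+1 + l.+1)%N exprD.
by ring.
Qed.

(** The binomial coefficient [(k - m) (k - m - 1) / 2], also for [k < m]. *)
Definition tri m k := if (m <= k)%N then 'C(k - m, 2) else 'C((m - k).+1, 2).

Lemma triSS m k : tri m.+1 k.+1 = tri m k.
Proof. by rewrite /tri ltnS !subSS. Qed.

Lemma tri_step m k : (tri m k.+1 + m = tri m k + k)%N.
Proof.
rewrite /tri; case: (leqP m k) => mk.
  by rewrite (leq_trans mk) // subSn // binS bin1 -addnA subnK.
have [->|mk'] : m = k.+1 \/ (k.+1 < m)%N by lia.
  by rewrite leqnn subnn subSnn bin_small // binn; lia.
rewrite leqNgt mk' /= (_ : (m - k = (m - k.+1).+1)%N); last by lia.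
by rewrite (binS (m - k.+1).+1) bin1 -addnA; congr addn; lia.
Qed.

Lemma qbin_thm n z :
  \prod_(i < n) (1 + z * Q ^+ i) = \sum_(k < n.+1) qbin n k * z ^+ k * Q ^+ tri 0 k.
Proof.
elim: n z => [|n IH] z; first by rewrite big_ord0 big_ord1 /=; ring.
rewrite big_ord_recl expr0 mulr1.
under eq_bigr => i _ do rewrite lift0 exprS mulrA.
rewrite IH {IH} mulrDl mul1r [RHS]big_ord_recl.
under [in RHS]eq_bigr => k _ do rewrite lift0 /= !mulrDl.
rewrite big_split addrCA [in RHS]addrC; congr (_ + _); last first.
  rewrite mulr_sumr; apply: eq_bigr => k _; rewrite exprMn.
  have := tri_step 0 k; rewrite addn0 => ->.
  by rewrite exprD exprS; ring.
rewrite big_ord_recl [in RHS]big_ord_recr /= (qbin_small (ltnSn n)).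
rewrite mulr0 !mul0r addr0; congr (_ + _); first by rewrite !qbin0 !expr0.
apply: eq_bigr => k _; rewrite /bump /= add1n exprMn.
by ring.
Qed.

(** The product of [1 + z Q^i] over [- m <= i < n], cleared of negative powers of
    [Q]: the version of the triple product that makes sense in any
    commutative ring. *)
Lemma finite_triple_product m n z :
  \prod_(i < m) (z + Q ^+ i.+1) * \prod_(i < n) (1 + z * Q ^+ i) =
  \sum_(k < (m + n).+1) qbin (m + n) k * z ^+ k * Q ^+ tri m k.
Proof.
elim: m => [|m IH]; first by rewrite big_ord0 mul1r qbin_thm.
rewrite big_ord_recr mulrAC {}IH mulrDr addSn addrC [RHS]big_ord_recl.
under [in RHS]eq_bigr => k _ do rewrite lift0 triSS qbinSS !mulrDl.
rewrite big_split addrCA [in RHS]addrC; congr (_ + _); last first.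
  by rewrite mulr_suml; apply: eq_bigr => k _; rewrite exprS; ring.
transitivity (1 * z ^+ 0 * Q ^+ tri m.+1 0 + \sum_(k < m + n)
    Q ^+ k.+1 * qbin (m + n) k.+1 * z ^+ k.+1 * Q ^+ tri m k); last first.
  congr (_ + _); rewrite big_ord_recr /= (qbin_small (ltnSn _)).
  by rewrite mulr0 !mul0r addr0.
rewrite mulr_suml big_ord_recl qbin0 !expr0 !mul1r; congr (_ + _).
  rewrite -exprD; congr (_ ^+ _).
  by rewrite /tri subn0 (binS m.+1) bin1; case: m => // m; rewrite addnC.
apply: eq_bigr => k _; rewrite lift0 -[LHS]mulrA -exprD /=.
have -> : (tri m k.+1 + m.+1 = tri m k + k.+1)%N.
  by have := tri_step m k; lia.
by rewrite exprD; ring.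
Qed.

End QBinomial.

(** * The triple product identity *)

(** The exponent [(c + d) j (j - 1) / 2 + c j]; on negative [j] the roles of
    [c] and [d] are exchanged. *)
Definition tri_exp (c d : nat) (j : int) : nat :=
  match j with
  | Posz l => ((c + d) * 'C(l, 2) + c * l)%N
  | Negz l => ((c + d) * 'C(l.+1, 2) + d * l.+1)%N
  end.

Lemma tri_expE c d j :
  2 * (tri_exp c d j)%:Z = (c + d)%:Z * (j * (j - 1)) + 2 * c%:Z * j.
Proof.
have bin2Z l : 2 * ('C(l.+1, 2))%:Z = l.+1%:Z * l%:Z.
  by have := mul_bin_diag l.+1 1; rewrite bin1 /=; lia.
case: j => [[|l]|l] /=; first by rewrite bin_small //; lia.
  have := bin2Z l; nia.
rewrite NegzE; have := bin2Z l; nia.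
Qed.

Lemma tri_exp11 j : (tri_exp 1 1 j)%:Z = j * j.
Proof. by have := tri_expE 1 1 j; nia. Qed.

Lemma tri_exp01 j : 2 * (tri_exp 0 1 j)%:Z = j * (j - 1).
Proof. by have := tri_expE 0 1 j; nia. Qed.

Lemma tri_exp12 j : 2 * (tri_exp 1 2 j)%:Z = j * (3 * j - 1).
Proof. by have := tri_expE 1 2 j; nia. Qed.

Lemma tri_exp21 j : 2 * (tri_exp 2 1 j)%:Z = j * (3 * j + 1).
Proof. by have := tri_expE 2 1 j; nia. Qed.

Lemma tri_exp_proper c d : (0 < c + d)%N -> proper (tri_exp c d).
Proof.
move=> cd; apply: proper_int => -[[|l]|l] //=.
  by rewrite binS bin1; nia.
by rewrite binS bin1; nia.
Qed.

Section TripleProduct.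
Variable K : fieldType.

Lemma qfact_qfin M n : qfact ('q^M : fps K) n = qfin (-1) M M n.
Proof.
rewrite /qfact /qfin; apply: eq_bigr => i _.
by rewrite rmorphN1 mulN1r fps_X_exp mulnS.
Qed.

Lemma euler_qfact M N n : (0 < M)%N -> (N <= n)%N ->
  eqmod N (euler K M) (qfact 'q^M n).
Proof. by move=> M0 Nn; rewrite qfact_qfin; apply: qprod_eqmod. Qed.

(** In [qbin (k + l) k = (k + l)_Q! / ((k)_Q! (l)_Q!)] each of the three factorials
    tends to the same infinite product. *)
Lemma euler_qbin M N k l : (0 < M)%N -> (N <= k)%N -> (N <= l)%N ->
  eqmod N (euler K M * qbin 'q^M (k + l) k) 1.
Proof.
move=> M0 Nk Nl; have Eu := euler_unit K M0.
rewrite -[X in eqmod _ X _](mulKr Eu) -[X in eqmod _ _ X](mulVr Eu).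
apply: eqmodM => //; rewrite [X in eqmod _ X _](_ : _ =
  qbin 'q^M (k + l) k * (euler K M * euler K M)); last by ring.
apply: (@eqmod_trans _ _ (qfact 'q^M (k + l))).
  rewrite -qbin_fact; apply: eqmodM => //.
  by apply: eqmodM; apply: euler_qfact.
by apply: eqmod_sym; apply: euler_qfact => //; apply: leq_trans (leq_addr _ _).
Qed.

Definition int_range m n := [seq (i%:Z - m%:Z)%R | i <- iota 0 (m + n).+1].

Lemma int_range_uniq m n : uniq (int_range m n).
Proof. by rewrite map_inj_uniq ?iota_uniq // => i j; lia. Qed.

Lemma mem_int_range m n k : (`|k| <= m)%N -> (`|k| <= n)%N ->
  k \in int_range m n.
Proof.
move=> km kn; apply/mapP; exists (absz (k + m%:Z)); last by lia.
by rewrite mem_iota; lia.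
Qed.

Lemma tri_exp_ge c d j : (0 < c + d)%N -> (`|j| <= (tri_exp c d j).+1)%N.
Proof. by case: j => [[|l]|l] //= cd; rewrite binS bin1; nia. Qed.

(** The passage to the limit in a finite triple product: a term whose exponent is
    less than [N] has [|j| <= N], so the factorials in its Gaussian binomial have
    at least [N] factors. *)
Lemma wsum_limit c d (w : int -> K) N m n : (0 < c + d)%N ->
  (N * 2 <= m)%N -> (N * 2 <= n)%N ->
  eqmod N
    (euler K (c + d) * \sum_(k < (m + n).+1) qbin 'q^(c + d) (m + n) k *
       (fps_const (w (k%:Z - m%:Z)) * 'q^(tri_exp c d (k%:Z - m%:Z))))
    (wsum w (tri_exp c d)).
Proof.
move=> cd Nm Nn; pose F k := fps_const (w (k%:Z - m%:Z)) *
  'q^(tri_exp c d (k%:Z - m%:Z)) : fps K.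
apply: (@eqmod_trans _ _ (\sum_(k < (m + n).+1) F k)).
  rewrite mulr_sumr; apply: eqmod_sum => k _; rewrite -/(F k) mulrA.
  have := @tri_exp_ge c d (k%:Z - m%:Z) cd.
  case: (leqP N (tri_exp c d (k%:Z - m%:Z))) => [Ne _|eN small].
    have F0 : eqmod N (F k) 0 by rewrite /F mulrC; apply: eqmod_X0.
    apply: (eqmod_trans _ (eqmod_sym F0)).
    by rewrite -[X in eqmod _ _ X](mulr0 (euler K (c + d) * qbin 'q^(c + d) (m + n) k));
      apply: eqmodM.
  have kmn := ltn_ord k.
  rewrite -[X in eqmod _ _ X]mul1r; apply: eqmodM => //.
  have := @euler_qbin (c + d) N k (m + n - k) cd; rewrite subnKC; last by lia.
  by apply; lia.
move=> e eN; rewrite fps_sumE (@wsumE _ _ w _ e (int_range m n)) ?int_range_uniq //.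
  rewrite big_map -(big_mkord xpredT (fun k => F k e)) /index_iota subn0.
  rewrite [RHS]big_mkcond; apply: eq_bigr => k _.
  by rewrite /F fps_constME fps_qE eq_sym; case: eqP; rewrite ?mulr1 ?mulr0.
by move=> j je; apply: mem_int_range; have := @tri_exp_ge c d j cd; lia.
Qed.

Lemma tri_tri_exp c d m k :
  (tri_exp c d (k%:Z - m%:Z) + c * m = c * k + (c + d) * tri m k)%N.
Proof.
rewrite /tri; case: leqP => mk.
  by rewrite (_ : k%:Z - m%:Z = (k - m)%N%:Z) /=; [nia|lia].
rewrite (_ : k%:Z - m%:Z = Negz (m - k).-1) /=; last by lia.
rewrite prednK; last by lia.
by rewrite (binS (m - k)) bin1; nia.
Qed.

Lemma expr_dist (A : comNzRingType) (eps : A) (k n : nat) : eps ^+ 2 = 1 ->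
  eps ^+ k = eps ^+ n * eps ^+ `|k%:Z - n%:Z|.
Proof.
move=> e2; have sq m : eps ^+ (m * 2) = 1 by rewrite mulnC exprM e2 expr1n.
rewrite -exprD; case: (leqP k n) => kn; last by congr (_ ^+ _); lia.
rewrite (_ : (n + _ = k + `|k%:Z - n%:Z| * 2)%N); last by lia.
by rewrite exprD sq mulr1.
Qed.

Lemma finite_theta (eps : K) c d n : eps ^+ 2 = 1 ->
  qfin eps d (c + d) n * qfin eps c (c + d) n =
  \sum_(k < (n + n).+1) qbin 'q^(c + d) (n + n) k *
    (fps_const (eps ^+ `|k%:Z - n%:Z|) * 'q^(tri_exp c d (k%:Z - n%:Z))).
Proof.
move=> e2; set z := fps_const eps * 'q^c : fps K.
have e0 : eps != 0 by apply/eqP => e; move/eqP: e2; rewrite e expr0n eq_sym oner_eq0.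
have z0 : z ^+ n != 0.
  rewrite expf_neq0 // mulf_neq0 ?fps_X_neq0 //.
  apply/eqP => /(congr1 (fun u : fps K => u 0%N)) /eqP.
  by rewrite /= (negbTE e0).
apply: (mulfI z0); have := finite_triple_product 'q^(c + d) n n z.
rewrite (_ : \prod_(i < n) (z + _) = z ^+ n * qfin eps d (c + d) n); last first.
  rewrite /qfin (_ : z ^+ n = \prod_(i < n) z); last first.
    by rewrite prodr_const card_ord.
  rewrite -big_split; apply: eq_bigr => i _ /=.
  rewrite -[RHS]/(z * (1 + fps_const eps * 'q^(d + (c + d) * i))) mulrDr mulr1.
  rewrite /z mulrACA -rmorphM -expr2 e2 rmorph1 mul1r -fps_XD fps_X_exp.
  by congr (_ + 'q^_); nia.
rewrite (_ : \prod_(i < n) (1 + _) = qfin eps c (c + d) n); last first.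
  apply: eq_bigr => i _; rewrite fps_X_exp /z -mulrA -fps_XD.
  by congr (_ + _ * 'q^_).
rewrite -mulrA => ->; rewrite mulr_sumr; apply: eq_bigr => k _.
rewrite fps_X_exp /z !exprMn !fps_X_exp -!rmorphXn.
rewrite (expr_dist k n e2) rmorphM; set u := qbin _ _ _; set e1 := fps_const (eps ^+ n).
set e3 := fps_const _; transitivity (u * e1 * e3 * ('q^(c * k) * 'q^((c + d) * tri n k))).
  by ring.
rewrite -fps_XD -tri_tri_exp addnC fps_XD.
by ring.
Qed.

(** Jacobi's triple product at [z = eps q^c]; the restriction [eps = 1] or
    [eps = -1] makes negative powers of [eps] unnecessary. *)
Theorem triple_product (eps : K) c d : (0 < c + d)%N -> eps ^+ 2 = 1 ->
  wsum (fun j : int => eps ^+ `|j|) (tri_exp c d) =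
  qprod eps c (c + d) * qprod eps d (c + d) * euler K (c + d).
Proof.
move=> cd e2; apply: eqmodP => N; apply: eqmod_sym; rewrite mulrC.
apply: (@eqmod_trans _ _ (euler K (c + d) *
   (qfin eps d (c + d) (N * 2) * qfin eps c (c + d) (N * 2)))).
  apply: eqmodM => //; rewrite mulrC.
  by apply: eqmodM; apply: qprod_eqmod => //; lia.
by rewrite finite_theta //; apply: wsum_limit.
Qed.

Lemma qbin_morph (A A' : comNzRingType) (f : {rmorphism A -> A'}) (Q : A) n k :
  f (qbin Q n k) = qbin (f Q) n k.
Proof.
elim: n k => [|n IH] [|k] /=; rewrite ?rmorph1 ?rmorph0 //.
by rewrite rmorphD rmorphM rmorphXn !IH.
Qed.

(** The derivative at [z = -1] of the finite triple product with [n] and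
    [n + 1] factors, in which [1 + z] is a factor. *)
Lemma finite_cube n :
  \sum_(k < (n + n.+1).+1) qbin 'q^1 (n + n.+1) k *
    (fps_const ((-1) ^+ `|k%:Z - n%:Z| * (k%:Z - n%:Z)%:~R) *
     'q^(tri_exp 0 1 (k%:Z - n%:Z))) = - qfact ('q^1 : fps K) n ^+ 2.
Proof.
pose N := (n + n.+1)%N; pose Q := ('q^1 : fps K)%:P.
have := finite_triple_product Q n n.+1 'X; rewrite -/N.
rewrite big_ord_recl expr0 mulr1 mulrCA; set G := \prod_(i < n) _ * _ .
pose C k := qbin ('q^1 : fps K) N k * 'q^1 ^+ tri n k.
rewrite (eq_bigr (fun k : 'I_N.+1 => (C k)%:P * 'X^k)) => [id|k _]; last first.
  by rewrite /C polyCM -mulrA [X in _ * X]mulrC mulrA rmorphXn qbin_morph.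
have Gm1 : G.[-1] = (-1) ^+ n * qfact 'q^1 n ^+ 2.
  rewrite /G hornerM !horner_prod expr2 mulrA; congr (_ * _).
    rewrite -[(-1) ^+ n](_ : \prod_(i < n) (-1) = _); last first.
      by rewrite prodr_const card_ord.
    rewrite -big_split; apply: eq_bigr => i _ /=.
    by rewrite !hornerE /Q; ring.
  by apply: eq_bigr => i _; rewrite !hornerE lift0 mulN1r.
have v : \sum_(k < N.+1) C k * (-1) ^+ k = 0.
  have /(congr1 (fun p : {poly fps K} => p.[-1])) := id.
  rewrite hornerM hornerD hornerC hornerX subrr mul0r horner_sum => /esym.
  by under eq_bigr do rewrite hornerM hornerC hornerXn.
have d : \sum_(k < N.+1) C k * ((-1) ^+ k.-1 *+ k) = (-1) ^+ n * qfact 'q^1 n ^+ 2.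
  rewrite -Gm1; have /(congr1 (fun p : {poly fps K} => p^`().[-1])) := id.
  rewrite derivM hornerD !hornerM derivD derivC derivX add0r hornerC mul1r.
  rewrite hornerD hornerC hornerX subrr mul0r addr0 => ->.
  rewrite raddf_sum horner_sum; apply: eq_bigr => k _.
  by rewrite /= derivM derivC mul0r add0r derivXn hornerM hornerC hornerMn hornerXn.
have e1 : (-1 : fps K) ^+ 2 = 1 by rewrite sqrrN expr1n.
apply: (mulfI (_ : (-1 : fps K) ^+ n != 0)); first by rewrite signr_eq0.
rewrite mulrN; transitivity (- (\sum_(k < N.+1) C k * ((-1) ^+ k.-1 *+ k)) -
  n%:R * \sum_(k < N.+1) C k * (-1) ^+ k); last by rewrite v d mulr0 subr0.
rewrite !mulr_sumr -sumrN -sumrB.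
apply: eq_bigr => k _; rewrite /C fps_X_exp mul1n.
have := tri_tri_exp 0 1 n k; rewrite !mul0n addn0 add0n mul1n => ->.
rewrite rmorphM rmorphXn rmorphN1 rmorph_int mulrzBr -!pmulrn.
rewrite (expr_dist k n e1); set s := (-1) ^+ absz _.
rewrite -[(-1) ^+ k.-1 *+ k]mulr_natr.
have -> : (-1) ^+ k.-1 * k%:R = - ((-1) ^+ n * s * k%:R) :> fps K.
  rewrite -(expr_dist k n e1); case: (nat_of_ord k) => [|m].
    by rewrite !mulr0 oppr0.
  by rewrite exprS; ring.
by ring.
Qed.

(** Jacobi's identity for the cube, indexed by all integers, so that each term
    of the usual sum is counted twice. *)
Theorem jacobi_cube :
  wsum (fun j : int => (-1) ^+ `|j| * (1 - 2 * j)%:~R) (tri_exp 0 1) =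
  2%:R * euler K 1 ^+ 3.
Proof.
have p01 : proper (tri_exp 0 1) by apply: tri_exp_proper.
have half : wsum (fun j : int => (-1) ^+ `|j| * j%:~R) (tri_exp 0 1) = - euler K 1 ^+ 3.
  apply: eqmodP => N; apply: eqmod_sym.
  apply: (@eqmod_trans _ _ (euler K 1 * - qfact 'q^1 (N * 2) ^+ 2)).
    rewrite exprS -mulrN -mulN1r -[- qfact _ _ ^+ 2]mulN1r.
    apply: eqmodM => //; apply: eqmodM => //; apply: eqmodX.
    by apply: euler_qfact => //; lia.
  rewrite -finite_cube.
  by apply: (@wsum_limit 0 1 (fun j => (-1) ^+ `|j| * j%:~R)) => //; lia.
pose s (j : int) := 1 - j.
have sK : cancel s s by move=> j; rewrite /s; lia.
have half' : wsum (fun j : int => (-1) ^+ `|j| * (1 - j)%:~R) (tri_exp 0 1) =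
    euler K 1 ^+ 3.
  rewrite -[RHS]opprK -half (wsum_reindex _ _ sK sK) -wsumN.
  apply: eq_wsum => j /=.
    have : (-1) ^+ (`|s j| + 1) = (-1) ^+ `|j| :> K.
      rewrite -[RHS]signr_odd -[LHS]signr_odd; congr (_ ^+ _); rewrite /s; lia.
    rewrite addn1 exprS mulN1r => <-; rewrite mulNr opprK.
    by congr (_ * _%:~R); rewrite /s; lia.
  by have := tri_expE 0 1 (s j); have := tri_expE 0 1 j; rewrite /s; nia.
have -> : 2%:R * euler K 1 ^+ 3 = euler K 1 ^+ 3 - - euler K 1 ^+ 3 by ring.
rewrite -{1}half' -half -wsumN -wsumD //; apply: eq_wsum => j //.
by rewrite -mulrBr -mulrzBr; congr (_ * (_ *~ _)); lia.
Qed.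
End TripleProduct.

(** * Theta series *)

Section Theta.
Variable K : fieldType.
Local Notation E := (euler K).

(** The theta function [sum q^(j^2)]. *)
Definition phi : fps K := wsum (fun=> 1) (tri_exp 1 1).
(** [phi(-q)]. *)
Definition phim : fps K := wsum (fun j : int => (-1) ^+ `|j|) (tri_exp 1 1).
(** Twice the series [psi(q) = sum_(n >= 0) q^(n (n + 1) / 2)] of Ramanujan. *)
Definition dpsi : fps K := wsum (fun=> 1) (tri_exp 0 1).
(** Twice the series of Jacobi for the cube of [f_1]. *)
Definition dcube : fps K :=
  wsum (fun j : int => (-1) ^+ `|j| * (1 - 2 * j)%:~R) (tri_exp 0 1).
(** The series [sum (6 j + 1) q^(j (3 j + 1) / 2)]. *)
Definition chi : fps K := wsum (fun j : int => (6 * j + 1)%:~R) (tri_exp 2 1).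

(** ** Product formulas for theta series *)

Definition oddp : fps K := qprod 1 1 2.

Lemma sqrN1 : (-1) ^+ 2 = 1 :> K. Proof. by rewrite sqrrN expr1n. Qed.

Lemma euler_dil m n : (0 < m)%N -> (0 < n)%N -> fps_dil m (E n) = E (m * n).
Proof. by move=> m0 n0; rewrite qprod_dil. Qed.

Theorem pentagonal :
  E 1 = wsum (fun j : int => (-1) ^+ `|j|) (tri_exp 1 2).
Proof.
rewrite triple_product ?sqrN1 // /E (@qprod_residues _ _ _ 1 3) //.
by rewrite !big_ord_recr big_ord0 /= mul1r.
Qed.

Lemma euler1_split : E 1 = qprod (-1) 1 2 * E 2.
Proof.
by rewrite /E (@qprod_residues _ _ _ 1 2) // !big_ord_recr big_ord0 /= mul1r.
Qed.

Lemma euler2_split : E 2 = qprod (-1) 2 4 * E 4.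
Proof.
by rewrite /E (@qprod_residues _ _ _ 2 2) // !big_ord_recr big_ord0 /= mul1r.
Qed.

Lemma oddp_mul : oddp * qprod (-1) 1 2 = qprod (-1) 2 4.
Proof. by rewrite /oddp qprodMN // expr1n. Qed.

Lemma phi_prod : phi = oddp ^+ 2 * E 2.
Proof.
rewrite /phi -[RHS]/(qprod 1 1 2 ^+ 2 * euler K (1 + 1)) expr2.
rewrite -triple_product ?expr1n //.
by apply: eq_wsum => // j; rewrite expr1n.
Qed.

Lemma phim_euler : phim * E 2 = E 1 ^+ 2.
Proof. by rewrite /phim triple_product ?sqrN1 // euler1_split; ring. Qed.

Lemma euler_alt : fps_alt (E 1) = oddp * E 2.
Proof.
rewrite euler1_split rmorphM /= (@qprod_alt _ _ 1 1) // (@qprod_alt _ _ 2 1) //.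
by rewrite expr1 sqrN1 mul1r mulrN1 opprK.
Qed.

Lemma phi_euler : phi * E 2 = fps_alt (E 1) ^+ 2.
Proof. by rewrite phi_prod euler_alt; ring. Qed.

Lemma euler_alt_mul : fps_alt (E 1) * E 1 * E 4 = E 2 ^+ 3.
Proof.
rewrite euler_alt euler1_split.
transitivity ((oddp * qprod (-1) 1 2) * E 4 * E 2 ^+ 2); first by ring.
by rewrite oddp_mul -euler2_split; ring.
Qed.

Lemma phi_phim : phi * phim * E 4 ^+ 2 = E 2 ^+ 4.
Proof.
have E2u := euler_unit K (isT : (0 < 2)%N).
apply: (mulIr E2u); apply: (mulIr E2u).
rewrite (_ : _ * E 2 = (phi * E 2) * (phim * E 2) * E 4 ^+ 2); last by ring.
rewrite phi_euler phim_euler.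
rewrite (_ : _ * E 4 ^+ 2 = (fps_alt (E 1) * E 1 * E 4) ^+ 2); last by ring.
by rewrite euler_alt_mul; ring.
Qed.

Lemma dpsi_euler : dpsi * E 1 = 2%:R * E 2 ^+ 2.
Proof.
rewrite /dpsi (eq_wsum (w' := fun j : int => 1 ^+ `|j|) (e' := tri_exp 0 1)) //; last first.
  by move=> j; rewrite expr1n.
rewrite triple_product ?expr1n // (qprod_rec _ 0) // fps_X0 rmorph1 mulr1 add0n.
have e : qprod 1 1 1 * E 1 = E 2 by rewrite qprodMN // expr1n.
by rewrite -e; ring.
Qed.

(** ** Rotations of the square lattice *)

(** The two cosets of the sublattice [x + y] even of [Z^2], the second one
    parametrised so that [(1 - 2 i)^2 + (1 - 2 j)^2 = 2 (x^2 + y^2)]. *)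
Definition parity_split (p : int * int + int * int) : int * int :=
  match p with
  | inl (i, j) => (i + j, i - j)
  | inr (i, j) => (1 - i - j, j - i)
  end.

Definition parity_join (p : int * int) : int * int + int * int :=
  let: (x, y) := p in
  if ((x + y) %% 2)%Z == 0 then inl (((x + y) %/ 2)%Z, ((x - y) %/ 2)%Z)
  else inr (((1 - x - y) %/ 2)%Z, ((1 - x + y) %/ 2)%Z).

Lemma parity_splitK : cancel parity_split parity_join.
Proof.
case=> -[i j]; rewrite /parity_split /parity_join.
  rewrite ifT; last by lia.
  by congr (inl (_, _)); lia.
rewrite ifF; last by lia.
by congr (inr (_, _)); lia.
Qed.

Lemma parity_joinK : cancel parity_join parity_split.
Proof.
case=> x y; rewrite /parity_join; case: eqP => h; rewrite /parity_split.
  by congr (_, _); lia.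
by congr (_, _); lia.
Qed.

Lemma wsum_parity (w : int * int -> K) e : proper e ->
  wsum w e = wsum (fun p => w (parity_split (inl p))) (fun p => e (parity_split (inl p)))
    + wsum (fun p => w (parity_split (inr p))) (fun p => e (parity_split (inr p))).
Proof.
move=> pe; rewrite (wsum_reindex _ _ parity_splitK parity_joinK) wsum_sum //.
exact: proper_inj parity_splitK pe.
Qed.

Lemma signr_int (i j : int) : ((i - j) %% 2)%Z = 0 ->
  (-1) ^+ `|i| = (-1) ^+ `|j| :> K.
Proof. by move=> ij; rewrite -signr_odd -[RHS]signr_odd; congr (_ ^+ _); lia. Qed.


Lemma signrN_int (i j : int) : ((i - j) %% 2)%Z = 1 ->
  (-1) ^+ `|i| = - (-1) ^+ `|j| :> K.
Proof.
move=> ij; rewrite -signr_odd -[(-1) ^+ `|j|]signr_odd.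
have -> : odd `|i| = ~~ odd `|j| by lia.
by rewrite signrN.
Qed.

Lemma signrD_int (i j : int) :
  (-1) ^+ `|i| * (-1) ^+ `|j| = (-1) ^+ `|(i + j)%R| :> K.
Proof. by rewrite -exprD -signr_odd -[RHS]signr_odd; congr (_ ^+ _); lia. Qed.

Let p11 : proper (tri_exp 1 1). Proof. exact: tri_exp_proper. Qed.
Let p01 : proper (tri_exp 0 1). Proof. exact: tri_exp_proper. Qed.

Lemma phi_sqr_parity :
  phi ^+ 2 = fps_dil 2 phi ^+ 2 + 'q^1 * fps_dil 4 dpsi ^+ 2.
Proof.
rewrite !expr2 /phi /dpsi !wsum_dil // !wsumM ?wsum_q //; try exact: proper_mul.
rewrite wsum_parity; last exact: proper_pair.
congr (_ + _); apply: eq_wsum => -[i j] //=.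
  have := tri_exp11 (i + j); have := tri_exp11 (i - j).
  by have := tri_exp11 i; have := tri_exp11 j; nia.
have := tri_exp11 (1 - i - j); have := tri_exp11 (j - i).
by have := tri_exp01 i; have := tri_exp01 j; nia.
Qed.

Lemma phim_sqr_parity :
  phim ^+ 2 = fps_dil 2 phi ^+ 2 - 'q^1 * fps_dil 4 dpsi ^+ 2.
Proof.
rewrite !expr2 /phi /dpsi /phim !wsum_dil // !wsumM ?wsum_q -?wsumN //;
  try exact: proper_mul.
rewrite wsum_parity; last exact: proper_pair.
congr (_ + _); apply: eq_wsum => -[i j] //=.
- rewrite (@signr_int (i + j) (i - j)); last by lia.
  by rewrite -expr2 sqrr_sign mul1r.
- have := tri_exp11 (i + j); have := tri_exp11 (i - j).
  by have := tri_exp11 i; have := tri_exp11 j; nia.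
- rewrite (@signrN_int (1 - i - j) (j - i)); last by lia.
  by rewrite mulNr -expr2 sqrr_sign mulr1.
- have := tri_exp11 (1 - i - j); have := tri_exp11 (j - i).
  by have := tri_exp01 i; have := tri_exp01 j; nia.
Qed.

Lemma phi_phim_dil : phi * phim = fps_dil 2 phim ^+ 2.
Proof.
have u4 := euler_unit K (isT : (0 < 4)%N).
apply: (mulIr u4); apply: (mulIr u4).
transitivity (phi * phim * E 4 ^+ 2); first by ring.
rewrite phi_phim; transitivity (fps_dil 2 (phim * E 2) ^+ 2).
  by rewrite phim_euler fps_dilX // euler_dil //; ring.
by rewrite fps_dilM // euler_dil //; ring.
Qed.

(** The squares of [phi(q)] and [phi(-q)] are the sum and the difference of the
    same two series, so the difference of the fourth powers is a product. *)
Lemma phi4_sub_phim4 :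
  phi * phim * (phi ^+ 4 - phim ^+ 4) = 16%:R * 'q^1 * E 4 ^+ 6.
Proof.
have u1 := euler_unit K (isT : (0 < 1)%N).
have u2 := euler_unit K (isT : (0 < 2)%N).
have u4 := euler_unit K (isT : (0 < 4)%N).
have cubeE : fps_dil 2 dpsi * phi * phim = 2%:R * E 2 ^+ 3.
  have d2 : fps_dil 2 dpsi * E 2 = 2%:R * E 4 ^+ 2.
    have := congr1 (fps_dil 2) dpsi_euler.
    rewrite fps_dilM // euler_dil // fps_dilM // fps_dilX // euler_dil // => ->.
    by rewrite fps_dil_nat.
  apply: (mulIr u2); apply: (mulIr u4); apply: (mulIr u4).
  transitivity (fps_dil 2 dpsi * E 2 * (phi * phim * E 4 ^+ 2)); first by ring.
  by rewrite d2 phi_phim; ring.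
have c4 : fps_dil 4 dpsi * fps_dil 2 phi * fps_dil 2 phim = 2%:R * E 4 ^+ 3.
  have := congr1 (fps_dil 2) cubeE.
  rewrite !fps_dilM // ?fps_dilX // euler_dil // fps_dil_dil // => ->.
  by rewrite fps_dil_nat //; ring.
transitivity (phi * phim * ((phi ^+ 2) ^+ 2 - (phim ^+ 2) ^+ 2)); first by ring.
rewrite phi_sqr_parity phim_sqr_parity phi_phim_dil.
transitivity (4%:R * 'q^1 * (fps_dil 4 dpsi * fps_dil 2 phi * fps_dil 2 phim) ^+ 2).
  by ring.
by rewrite c4; ring.
Qed.

Hypothesis two_neq0 : (2%:R : K) != 0.

(** The Wronskian of [phi(q)] and [phi(-q)]: its terms carry the weight
    [y^2 - x^2], a product of two linear forms that separate after rotation. *)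
Lemma wronskian :
  phim * fps_D phi - phi * fps_D phim = 'q^1 * fps_dil 4 dcube ^+ 2.
Proof.
rewrite [phi * _]mulrC expr2 /phi /phim /dcube !wsum_D !wsum_dil // !wsumM ?wsum_q -?wsumN;
  try exact: proper_mul; try by [].
rewrite -wsumD; last exact: proper_pair.
rewrite wsum_parity; last exact: proper_pair.
rewrite [X in X + _](@wsum_odd _ _ (fun p => (- p.1, p.2))) ?add0r //.
- apply: eq_wsum => -[i j] /=.
    rewrite mulrACA signrD_int (@signrN_int (1 - i - j) (i + j)); last by lia.
    rewrite !mulr1 !(pmulrn 1) tri_exp11 tri_exp11 !(rmorphB, rmorphM) /=.
    by ring.
  by have := tri_exp11 (1 - i - j); have := tri_exp11 (j - i);
     have := tri_exp01 i; have := tri_exp01 j; nia.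
- by case=> i j; rewrite /= opprK.
- case=> i j /=.
  rewrite (@signr_int (- i + j) (i + j)); last by lia.
  by rewrite !mulr1 !(pmulrn 1) !tri_exp11 !(rmorphB, rmorphM, rmorphD) /=; ring.
- case=> i j /=; apply/eqP; rewrite -eqz_nat !PoszD !tri_exp11.
  by apply/eqP; ring.
Qed.

(** ** A rotation of the lattice of norm 3 *)

(** With [u = 1 + 2 (k - j)] and [v = 1 - 2 j - 4 k] one has
    [3 ((1 - 2 j)^2 + 8 k^2) = 2 u^2 + v^2]; the three components are the classes
    of [k - j] modulo 3, and [inr (inl _)] is the one where 3 divides [u]
    and [v]. *)
Definition norm3_split (p : int * int + (int * int + int * int)) : int * int :=
  match p with
  | inl (d, i) => (2 * d - i, - d - i)
  | inr (inl (d, l)) => (l - 2 * d - 1, l + d)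
  | inr (inr (d, i)) => (i - 2 * d + 1, i + d)
  end.

Definition norm3_join (p : int * int) : int * int + (int * int + int * int) :=
  let: (j, k) := p in
  if ((k - j) %% 3)%Z == 0 then
    inl (((j - k) %/ 3)%Z, - ((j - k) %/ 3)%Z - k)
  else if ((k - j) %% 3)%Z == 1 then
    inr (inl (((k - j - 1) %/ 3)%Z, k - ((k - j - 1) %/ 3)%Z))
  else inr (inr (((k - j + 1) %/ 3)%Z, k - ((k - j + 1) %/ 3)%Z)).

Lemma norm3_splitK : cancel norm3_split norm3_join.
Proof.
case=> [[d i]|[[d l]|[d i]]]; rewrite /norm3_split /norm3_join.
- rewrite ifT; last by lia.
  by congr (inl (_, _)); lia.
- rewrite ifF ?ifT; try lia.
  by congr (inr (inl (_, _))); lia.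
- rewrite ifF ?ifF; try lia.
  by congr (inr (inr (_, _))); lia.
Qed.

Lemma norm3_joinK : cancel norm3_join norm3_split.
Proof.
case=> j k; rewrite /norm3_join; case: eqP => h; last case: eqP => h';
  rewrite /norm3_split; congr (_, _); lia.
Qed.

(** The weight [1 - 2 j] may be replaced by [v = 1 - 2 j - 4 k], and the sign depends
    only on [u]; the two classes with [u] prime to 3 give the same product, and the
    third one vanishes because a symmetry of the exponents changes the sign of [v]. *)
Lemma dcube_phim : dcube * phim = 2%:R * (chi * E 2).
Proof.
have p21 : proper (tri_exp 2 1) by exact: tri_exp_proper.
have p12 : proper (tri_exp 1 2) by exact: tri_exp_proper.
have E2 : E 2 = wsum (fun j : int => (-1) ^+ `|j|) (fun j => 2 * tri_exp 1 2 j)%N.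
  by rewrite -wsum_dil // -pentagonal euler_dil.
(* the additional weight [- 4 k] is odd in [k] *)
have -> : dcube * phim = wsum
    (fun p : int * int => (-1) ^+ `|(p.1 + p.2)%R| * (1 - 2 * p.1 - 4 * p.2)%:~R)
    (fun p => tri_exp 0 1 p.1 + tri_exp 1 1 p.2)%N.
  rewrite /dcube /phim wsumM // -[LHS]addr0.
  have <- : wsum (fun p : int * int => (-1) ^+ `|p.1| * ((-1) ^+ `|p.2| * (- 4 * p.2)%:~R))
      (fun p => tri_exp 0 1 p.1 + tri_exp 1 1 p.2)%N = 0 :> fps K.
    apply: (@wsum_odd _ _ (fun p => (p.1, - p.2))) => // [[j k]|[j k]|[j k]] /=.
    - by rewrite opprK.
    - by rewrite abszN mulrN rmorphN /= !mulrN.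
    - by congr (_ + _)%N; apply/eqP; rewrite -eqz_nat !tri_exp11; apply/eqP; ring.
  rewrite -wsumD; last exact: proper_pair.
  apply: eq_wsum => -[j k] //=; rewrite -signrD_int !(rmorphB, rmorphM, rmorphN) /=.
  by ring.
have pe : proper (fun p : int * int => tri_exp 0 1 p.1 + tri_exp 1 1 p.2)%N.
  exact: proper_pair.
rewrite (wsum_reindex _ _ norm3_splitK norm3_joinK).
have pe' := proper_inj norm3_splitK pe.
have pe'' : proper (((fun p : int * int => tri_exp 0 1 p.1 + tri_exp 1 1 p.2)%N
    \o norm3_split) \o inr : int * int + int * int -> nat).
  move=> n; have [r re] := pe' n.
  exists (pmap (fun x => if x is inr i then Some i else None) r) => i /re ir.
  by rewrite mem_pmap; apply/mapP; exists (inr i).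
rewrite wsum_sum // [X in _ + X]wsum_sum //.
have prodE : chi * E 2 = wsum
    (fun p : int * int => (-1) ^+ `|p.1| * (6 * p.2 + 1)%:~R)
    (fun p => 2 * tri_exp 1 2 p.1 + tri_exp 2 1 p.2)%N.
  by rewrite mulrC E2 /chi wsumM //; apply: proper_mul.
rewrite [X in _ + (X + _)](@wsum_odd _ _ (fun p : int * int => (p.1, 1 - p.2))) ?add0r //.
- rewrite prodE mulr_natl mulr2n; congr (_ + _); apply: eq_wsum => -[d i] /=.
  + rewrite (@signr_int (2 * d - i + (- d - i)) d); last by lia.
    by congr (_ * _%:~R); lia.
  + have := tri_exp12 d; have := tri_exp21 i; have := tri_exp01 (2 * d - i).
    by have := tri_exp11 (- d - i); nia.
  + rewrite (@signrN_int (i - 2 * d + 1 + (i + d)) d); last by lia.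
    rewrite mulNr; apply: etrans (esym (mulrN _ _)) _; congr (_ * _).
    by apply: etrans (esym (mulrNz _ _)) _; congr (_ *~ _); lia.
  + have := tri_exp12 d; have := tri_exp21 i; have := tri_exp01 (i - 2 * d + 1).
    by have := tri_exp11 (i + d); nia.
- by case=> d l; rewrite /=; congr (_, _); lia.
- case=> d l /=.
  rewrite (@signr_int (1 - l - 2 * d - 1 + (1 - l + d)) (l - 2 * d - 1 + (l + d)));
    last by lia.
  apply: etrans (mulrN _ _); congr (_ * _).
  by apply: etrans (mulrNz _ _); congr (_ *~ _); lia.
- case=> d l /=; apply/eqP; rewrite -eqz_nat !PoszD; apply/eqP.
  apply: (@mulfI _ (2 : int) isT); rewrite !mulrDr !tri_exp01 !tri_exp11.
  by ring.
Qed.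

Lemma dcubeE : dcube = 2%:R * E 1 ^+ 3. Proof. exact: jacobi_cube. Qed.

Theorem chi_euler : chi * E 2 ^+ 2 = E 1 ^+ 5.
Proof.
have two0 : (2%:R : fps K) != 0.
  by rewrite -(rmorph_nat (@fps_const K)); apply/eqP =>
    /(congr1 (fun u : fps K => u 0%N)) /eqP; rewrite /= (negbTE two_neq0).
apply: (mulfI two0); transitivity (2%:R * (chi * E 2) * E 2); first by ring.
rewrite -dcube_phim dcubeE; transitivity (2%:R * E 1 ^+ 3 * (phim * E 2)); first by ring.
by rewrite phim_euler; ring.
Qed.

End Theta.

(** * Differential algebra in characteristic 7 *)

Section DifferentialAlgebra.
Variable A : comNzRingType.
Variable D : A -> A.
Hypothesis char7 : 7%:R = 0 :> A.
Hypothesis derD : {morph D : u v / u + v}.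
Hypothesis derM : forall u v, D (u * v) = D u * v + u * D v.

(** Identities modulo 7 are checked by [ring] over the integers, with an explicit
    cofactor [c] of 7. *)
Lemma eq_char7 (u v c : A) : u = v + 7%:R * c -> u = v.
Proof. by rewrite char7 mul0r addr0. Qed.

Lemma der0 : D 0 = 0.
Proof. by apply: (@addrI _ (D 0)); rewrite -derD !addr0. Qed.
Lemma derN u : D (- u) = - D u.
Proof. by apply: (@addrI _ (D u)); rewrite -derD !subrr der0. Qed.
Lemma der1 : D 1 = 0.
Proof. by apply: (@addrI _ (D 1)); rewrite -{3}[1]mulr1 derM mulr1 mul1r addr0. Qed.
Lemma der_nat n : D n%:R = 0.
Proof. by elim: n => [|n IH]; rewrite ?der0 // -natr1 derD IH der1 addr0. Qed.
Lemma derX u n : D (u ^+ n.+1) = n.+1%:R * u ^+ n * D u.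
Proof.
elim: n => [|n IH]; first by rewrite expr0 expr1; ring.
by rewrite exprS derM IH -[n.+2%:R]natr1 !exprS; ring.
Qed.

(** The factor by which [(D + c)^3] multiplies [f] when [D + c] multiplies it by
    [w]. *)
Definition cubic w := D (D w) + 3%:R * w * D w + w ^+ 3.

Lemma cubicE (c w f : A) : D c = 0 -> D f + c * f = w * f ->
  iter 3 (fun u => D u + c * u) f = cubic w * f.
Proof.
move=> Dc Df /=; rewrite Df; have {}Df : D f = w * f - c * f by rewrite -Df; ring.
by rewrite /cubic !(derD, derN, derM, Df, Dc); ring.
Qed.

(* [x = phi(q)^4], [y = phi(-q)^4], and [al], [be] are the logarithmic derivatives
   of [phi(q)] and [phi(-q)]. *)
Variables x y al be : A.
Hypothesis x_reg : forall u, x * u = 0 -> u = 0.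
Hypothesis Dx : D x = 4%:R * x * al.
Hypothesis Dy : D y = 4%:R * y * be.
Hypothesis al_be : 4%:R * (al - be) = x - y.

Lemma be_al : be = al - 2%:R * (x - y).
Proof.
apply: (@eq_char7 _ _ (al - be)); rewrite -al_be; ring.
Qed.

Definition cubic_quotient w := 64%:R * al ^+ 2 + 16%:R * D al + 12%:R * D w +
  48%:R * al * w + 192%:R * x * al + 12%:R * w ^+ 2 + 48%:R * x * w +
  64%:R * x ^+ 2.

Lemma cubic_diff w : cubic (w + 4%:R * x) - cubic w = x * cubic_quotient w.
Proof.
by rewrite /cubic_quotient /cubic !(derD, derM, Dx, der_nat, der0); ring.
Qed.

(* [w] and [w + 4 x] are the shifted logarithmic derivatives of [f_4^3] and
   [f_1^3]. *)
Let w := 3%:R * al - x - 2%:R * y.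
Hypothesis cubic_w : cubic w = 1.
Hypothesis cubic_w4 : cubic (w + 4%:R * x) = 1.

(** The difference of the two third order equations is divisible by [x], and
    the quotient contains no second derivative of [al]. *)
Lemma D_al : D al = 2%:R * al ^+ 2 + x * y - y ^+ 2.
Proof.
have st0 : cubic_quotient w = 0.
  by apply: x_reg; rewrite -cubic_diff cubic_w cubic_w4 subrr.
have Dw : D w = 3%:R * D al - 4%:R * x * al - 8%:R * y * be.
  by rewrite /w !(derD, derN, derM, Dx, Dy, der_nat, der0); ring.
(* the coefficient of [D al] in [cubic_quotient w] is 52, of inverse 5 mod 7 *)
rewrite -[RHS]addr0 -(mulr0 5%:R) -st0.
apply: (@eq_char7 _ _ (- 37%:R * D al - 226%:R * al ^+ 2 - 120%:R * al * x +
  240%:R * al * y - 20%:R * x ^+ 2 - 103%:R * x * y + 103%:R * y ^+ 2)).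
by rewrite /cubic_quotient Dw /w be_al; ring.
Qed.

(** Up to sign and homogenisation in [t = y / x], the Hasse invariant
    [1 + 2 t + 2 t^2 + t^3] in characteristic 7 of the curve
    [v^2 = u (u - 1) (u - t)]. *)
Definition hasse := - (x ^+ 3 + 2%:R * x ^+ 2 * y + 2%:R * x * y ^+ 2 + y ^+ 3).

(** Once [D al] is known, [cubic w] is a polynomial in [al], [x] and [y].  The
    variable [al] disappears from it by Bol's identity: [f_4^3] has weight [3 / 2],
    which is [1 - 3] modulo 7. *)
Lemma hasse1 : hasse = 1.
Proof.
rewrite -cubic_w; apply: esym.
have Dw : D w = 6%:R * al ^+ 2 - 4%:R * al * x - 8%:R * al * y + 19%:R * x * y -
    19%:R * y ^+ 2.
  by rewrite /w !(derD, derN, derM, Dx, Dy, der_nat, der0) D_al be_al; ring.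
apply: (@eq_char7 _ _ (15%:R * al ^+ 3 - 15%:R * al ^+ 2 * x -
  30%:R * al ^+ 2 * y + 3%:R * al * x ^+ 2 + 69%:R * al * x * y -
  45%:R * al * y ^+ 2 - 31%:R * x ^+ 2 * y + 55%:R * x * y ^+ 2 - 27%:R * y ^+ 3)).
rewrite /cubic Dw !(der_nat, der0, derD, derN, derM, derX, Dx, Dy) D_al be_al /hasse /w.
by ring.
Qed.

Definition al_poly := x ^+ 3 * y + x ^+ 2 * y ^+ 2 + 3%:R * x * y ^+ 3 + 2%:R * y ^+ 4.

(** In [D hasse = 0] the coefficient of [al] is [12 hasse = 12], because [hasse] is
    homogeneous. *)
Lemma al_hasse : al = al_poly.
Proof.
have Dh : D hasse = 0 by rewrite hasse1 der1.
have {}Dh : 3%:R * D hasse - al * (hasse - 1) = 0.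
  by rewrite Dh hasse1; ring.
rewrite -[RHS]addr0 -Dh.
apply: (@eq_char7 _ _ (5%:R * al * x ^+ 3 + 10%:R * al * x ^+ 2 * y +
  10%:R * al * x * y ^+ 2 + 5%:R * al * y ^+ 3 - 7%:R * x ^+ 3 * y -
  7%:R * x ^+ 2 * y ^+ 2 + 3%:R * x * y ^+ 3 + 10%:R * y ^+ 4)).
rewrite /hasse !(der_nat, der0, derD, derN, derM, derX, Dx, Dy) be_al /al_poly.
by ring.
Qed.

(** ** Iterates of a shifted derivation *)

Variable h : A.
Hypothesis Dh : D h = (x - 3%:R * y - al + 2%:R) * h.

Let e u := D u - 2%:R * u.

Lemma e_step v v' c : D v + (x - 3%:R * y - al) * v = v' + 7%:R * c ->
  e (v * h) = v' * h.
Proof.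
move=> /eq_char7 <-; rewrite /e derM Dh; ring.
Qed.

(* [h] stands for [phi (f_2 f_4)^6], of weight [13 / 2], which is [1 - 5] modulo 7;
   accordingly [al] is absent from the fifth factor. *)
Let v1 :=
  - al + x - 3%:R * y.
Let v2 :=
  - al ^+ 2 + 2%:R * al * x + al * y + x ^+ 2 + 3%:R * x * y.
Let v3 :=
  - 3%:R * al ^+ 3 + 2%:R * al ^+ 2 * x + al ^+ 2 * y + 2%:R * al * x ^+ 2 -
  al * x * y + x ^+ 3 - x ^+ 2 * y - y ^+ 3.
Let v4 :=
  - al ^+ 4 - 3%:R * al ^+ 3 * x + 2%:R * al ^+ 3 * y - al ^+ 2 * x ^+ 2 -
  3%:R * al ^+ 2 * x * y - al * x ^+ 3 + al * x ^+ 2 * y + al * y ^+ 3 +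
  x ^+ 4 - x ^+ 3 * y - x ^+ 2 * y ^+ 2 + 3%:R * x * y ^+ 3.
Let v5 :=
  x ^+ 5 + 3%:R * x ^+ 4 * y - 2%:R * x ^+ 3 * y ^+ 2 + x ^+ 2 * y ^+ 3 +
  x * y ^+ 4 - y ^+ 5.
Let v6 :=
  - 2%:R * al * x ^+ 5 + al * x ^+ 4 * y - 3%:R * al * x ^+ 3 * y ^+ 2 -
  2%:R * al * x ^+ 2 * y ^+ 3 - 2%:R * al * x * y ^+ 4 + 2%:R * al * y ^+ 5
  + x ^+ 6 - 3%:R * x ^+ 5 * y + 3%:R * x ^+ 4 * y ^+ 2 -
  3%:R * x ^+ 2 * y ^+ 4 - 2%:R * x * y ^+ 5 - 2%:R * y ^+ 6.

Let der_rules := (der_nat, der0, derD, derN, derM, derX, Dx, Dy, D_al).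

Lemma e_step2 : e (v1 * h) = v2 * h.
Proof.
apply: (@e_step _ _ (
  - al * y + 2%:R * x * y - 2%:R * y ^+ 2)).
by rewrite /v1 /v2 !der_rules be_al; ring.
Qed.

Lemma e_step3 : e (v2 * h) = v3 * h.
Proof.
apply: (@e_step _ _ (
  al ^+ 2 * x + al ^+ 2 * y + al * x ^+ 2 + al * x * y + al * y ^+ 2 -
  3%:R * x ^+ 2 * y + 2%:R * x * y ^+ 2)).
by rewrite /v2 /v3 !der_rules be_al; ring.
Qed.

Lemma e_step4 : e (v3 * h) = v4 * h.
Proof.
apply: (@e_step _ _ (
  - 2%:R * al ^+ 4 + 2%:R * al ^+ 3 * x + 2%:R * al ^+ 3 * y +
  3%:R * al ^+ 2 * x ^+ 2 - 4%:R * al ^+ 2 * x * y + 2%:R * al ^+ 2 * y ^+ 2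
  + 2%:R * al * x ^+ 3 - al * x ^+ 2 * y - al * x * y ^+ 2 -
  2%:R * al * y ^+ 3 + x ^+ 3 * y - x ^+ 2 * y ^+ 2 + 3%:R * x * y ^+ 3 -
  3%:R * y ^+ 4)).
by rewrite /v3 /v4 !der_rules be_al; ring.
Qed.

Lemma e_step5 : e (v4 * h) = v5 * h.
Proof.
apply: (@e_step _ _ (
  - al ^+ 5 - 4%:R * al ^+ 4 * x + 3%:R * al ^+ 4 * y -
  2%:R * al ^+ 3 * x ^+ 2 - 6%:R * al ^+ 3 * x * y + 2%:R * al ^+ 3 * y ^+ 2
  - 2%:R * al ^+ 2 * x ^+ 3 + 4%:R * al ^+ 2 * x ^+ 2 * y + al ^+ 2 * y ^+ 3
  + 2%:R * al * x ^+ 4 - 3%:R * al * x ^+ 3 * y -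
  2%:R * al * x ^+ 2 * y ^+ 2 + 4%:R * al * x * y ^+ 3 + 3%:R * al * y ^+ 4
  + 2%:R * x ^+ 3 * y ^+ 2 - 12%:R * x ^+ 2 * y ^+ 3 + 9%:R * x * y ^+ 4)).
by rewrite /v4 /v5 !der_rules be_al; ring.
Qed.

Lemma e_step6 : e (v5 * h) = v6 * h.
Proof.
apply: (@e_step _ _ (
  3%:R * al * x ^+ 5 + 8%:R * al * x ^+ 4 * y - 5%:R * al * x ^+ 3 * y ^+ 2
  + 3%:R * al * x ^+ 2 * y ^+ 3 + 3%:R * al * x * y ^+ 4 -
  3%:R * al * y ^+ 5 - 3%:R * x ^+ 5 * y + 6%:R * x ^+ 4 * y ^+ 2 -
  7%:R * x ^+ 3 * y ^+ 3 - x ^+ 2 * y ^+ 4 + 10%:R * x * y ^+ 5 -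
  5%:R * y ^+ 6)).
by rewrite /v5 /v6 !der_rules be_al; ring.
Qed.

Theorem iter6_shifted_D :
  iter 6 e h = (1 - 2%:R * x ^+ 6 * y * (x - y) ^+ 2) * h.
Proof.
rewrite /= (_ : e h = v1 * h); last by rewrite /e Dh /v1; ring.
rewrite e_step2 e_step3 e_step4 e_step5 e_step6; congr (_ * _).
(* this multiple of [hasse - 1] makes the terms of degree 0, 6 and 9 agree *)
have h1 : (
    2%:R * x ^+ 4 * y ^+ 2 - 3%:R * x ^+ 3 * y ^+ 3 + x ^+ 3 +
    3%:R * x ^+ 2 * y ^+ 4 + 2%:R * x ^+ 2 * y + x * y ^+ 5 +
    2%:R * x * y ^+ 2 - 3%:R * y ^+ 6 + y ^+ 3 - 1) *
    (hasse - 1) = 0 by rewrite hasse1 subrr mulr0.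
apply: esym; rewrite -[RHS]addr0 -h1.
apply: (@eq_char7 _ _ (
  x ^+ 7 * y ^+ 2 + x ^+ 6 * y ^+ 3 + x ^+ 5 * y ^+ 4 + x ^+ 5 * y +
  2%:R * x ^+ 4 * y ^+ 5 + x ^+ 4 * y ^+ 2 + 2%:R * x ^+ 3 * y ^+ 6 +
  x ^+ 3 * y ^+ 3 + x ^+ 2 * y ^+ 7 + 2%:R * x ^+ 2 * y ^+ 4 - x * y ^+ 8 +
  x * y ^+ 5 - y ^+ 9)).
by rewrite /v6 al_hasse /al_poly /hasse; ring.
Qed.

End DifferentialAlgebra.

(** * The theta series modulo 7 *)

Section ModSeven.
Variable F : fieldType.
Hypothesis F7_pchar : 7%N \in [pchar F].
Hypothesis F7_fermat : forall t : F, t ^+ 7 = t.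
Local Notation E := (euler F).
Local Notation phi := (phi F).
Local Notation phim := (phim F).
Local Notation dcube := (dcube F).
Local Notation D := (@fps_D F).

Lemma F7_7 : (7%:R : F) = 0. Proof. exact: pcharf0 F7_pchar. Qed.

Lemma F7_two : (2%:R : F) != 0.
Proof. by rewrite -(dvdn_pcharf F7_pchar). Qed.

Lemma natr_mod_F7 m : (m %% 7)%:R = m%:R :> F.
Proof. by rewrite [in RHS](divn_eq m 7) natrD natrM F7_7 mulr0 add0r. Qed.

Lemma F7_char : (7%:R : fps F) = 0.
Proof. by rewrite -(rmorph_nat (@fps_const F)) F7_7 rmorph0. Qed.

Lemma fps_frobenius7 (u : fps F) : u ^+ 7 = fps_dil 7 u.
Proof. by apply: fps_frobenius => // n. Qed.

Let u1 : E 1 \is a GRing.unit := euler_unit F (ltn0Sn _).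
Let u2 : E 2 \is a GRing.unit := euler_unit F (ltn0Sn _).
Let u4 : E 4 \is a GRing.unit := euler_unit F (ltn0Sn _).

Lemma phi_unit : phi \is a GRing.unit.
Proof. by rewrite phi_prod unitrM unitrX // qprod_unit. Qed.

Lemma phim_unit : phim \is a GRing.unit.
Proof.
have : phim * E 2 \is a GRing.unit by rewrite phim_euler unitrX.
by rewrite unitrM => /andP[].
Qed.

Lemma two_unit : (2%:R : fps F) \is a GRing.unit.
Proof. by rewrite fps_unitE -(rmorph_nat (@fps_const F)) F7_two. Qed.

Let x := phi ^+ 4.
Let y := phim ^+ 4.
Let al := D phi / phi.
Let be := D phim / phim.
Let l1 := D (E 1) / E 1.
Let l2 := D (E 2) / E 2.
Let l4 := D (E 4) / E 4.

Let Dphi : D phi = al * phi. Proof. by rewrite divrK // phi_unit. Qed.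
Let Dphim : D phim = be * phim. Proof. by rewrite divrK // phim_unit. Qed.
Let D1 : D (E 1) = l1 * E 1. Proof. by rewrite divrK. Qed.
Let D2 : D (E 2) = l2 * E 2. Proof. by rewrite divrK. Qed.
Let D4 : D (E 4) = l4 * E 4. Proof. by rewrite divrK. Qed.

Let DA : {morph D : u v / u + v}. Proof. exact: raddfD. Qed.
Let DM := @fps_DM F.

Lemma dcube4E : fps_dil 4 dcube = 2%:R * E 4 ^+ 3.
Proof.
by rewrite dcubeE fps_dilM // fps_dil_nat // fps_dilX // euler_dil.
Qed.

Lemma eq_mod7 (u v c : fps F) : u = v + 7%:R * c -> u = v.
Proof. exact: (eq_char7 F7_char). Qed.

Lemma D_x : D x = 4%:R * x * al.
Proof. by rewrite /x fps_DX Dphi; ring. Qed.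

Lemma D_y : D y = 4%:R * y * be.
Proof. by rewrite /y fps_DX Dphim; ring. Qed.

Lemma al_sub_be : 4%:R * (al - be) = x - y.
Proof.
apply: (mulIr phi_unit); apply: (mulIr phim_unit).
transitivity (4%:R * (phim * D phi - phi * D phim)); first by rewrite Dphi Dphim; ring.
transitivity (phi * phim * (phi ^+ 4 - phim ^+ 4)); last by rewrite /x /y; ring.
rewrite (wronskian F7_two) (phi4_sub_phim4 F) dcube4E.
by ring.
Qed.

Let be_al : be = al - 2%:R * (x - y).
Proof. exact: (be_al F7_char al_sub_be). Qed.

(** The derivative of the formula for [x - y]. *)
Lemma log_E4 : 1 + 6%:R * l4 = 5%:R * al + be + y.
Proof.
have S := phi4_sub_phim4 F; rewrite -/x -/y in S.
have S0 : phi * phim * (x - y) != 0.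
  have n0 (u : fps F) : u \is a GRing.unit -> u != 0.
    by apply: contraTneq => ->; rewrite unitr0.
  rewrite S; have -> : 16%:R * 'q^1 * E 4 ^+ 6 = 2%:R ^+ 4 * 'q^1 * E 4 ^+ 6 by ring.
  apply: mulf_neq0; last by rewrite expf_neq0 // n0.
  by apply: mulf_neq0; [rewrite expf_neq0 // n0 // two_unit|apply: fps_X_neq0].
apply: (mulfI S0); have := congr1 D S.
rewrite [LHS]DM [D (phi * phim)]DM raddfB [in LHS]/= D_x D_y Dphi Dphim.
rewrite [RHS]DM [D (16%:R * _)]DM fps_DX D4 fps_D_q fps_D_nat.
move=> e; transitivity (16%:R * 'q^1 * E 4 ^+ 6 * (1 + 6%:R * l4)); first by rewrite S.
transitivity (phi * phim * ((al + be) * (x - y) + 4%:R * x * al - 4%:R * y * be));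
  last first.
  have -> : phi * phim * ((al + be) * (x - y) + 4%:R * x * al - 4%:R * y * be) =
    phi * phim * ((al + be) * (x - y) + 4%:R * al * (x - y) + y * (4%:R * (al - be))).
    by ring.
  by rewrite al_sub_be; ring.
by etransitivity; last (etransitivity; [exact: (esym e)|]); ring.
Qed.

Lemma log_E2 : 4%:R * l2 = al + be + 2%:R * l4.
Proof.
have P := phi_phim F; apply: (mulIr (unitrX 4 u2)).
have := congr1 D P; rewrite [LHS]DM [D (phi * phim)]DM !fps_DX Dphi Dphim D4 D2 => e.
transitivity (4%:R * E 2 ^+ 3 * (l2 * E 2)); first by ring.
by rewrite -e -P; ring.
Qed.

Lemma log_E1 : 2%:R * l1 = be + l2.
Proof.
have P := phim_euler F; apply: (mulIr (unitrX 2 u1)).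
have := congr1 D P; rewrite [LHS]DM fps_DX Dphim D2 D1 => e.
transitivity (2%:R * E 1 ^+ 1 * (l1 * E 1)); first by ring.
by rewrite -e -P; ring.
Qed.

(** ** The third order equations *)

Lemma D_wsum_shift (I : choiceType) (w : I -> F) e c : proper e ->
  D (wsum w e) + c%:R * wsum w e = wsum (fun i => (e i + c)%:R * w i) e.
Proof.
move=> pe; rewrite wsum_D -(rmorph_nat (@fps_const F)) -wsumZ -wsumD //.
by apply: eq_wsum => i //; rewrite natrD mulrDl.
Qed.

(** Since [t^7 = t], the series [sum t q^((t^2 - 1) / 8)] of the cube is fixed by
    the third power of a shift of [D]. *)
Lemma dcube_cubic m : (m %% 7 = 1)%N \/ (m %% 7 = 4)%N ->
  iter 3 (fun u => D u + m%:R * u) (fps_dil m dcube) = fps_dil m dcube.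
Proof.
move=> m14; have m0 : (0 < m)%N by case: m m14 => // -[].
have p01 : proper (fun j => m * tri_exp 0 1 j)%N.
  by apply: proper_mul => //; apply: tri_exp_proper.
rewrite /dcube wsum_dil //= !D_wsum_shift //; apply: eq_wsum => j //.
set t : F := (1 - 2 * j)%:~R; set s := (-1) ^+ _.
have -> : (m * tri_exp 0 1 j + m)%:R = m%:R * t ^+ 2 :> F.
  rewrite natrD natrM -[in X in _ + X](mulr1 m%:R) -mulrDr; congr (_ * _).
  have := congr1 (fun i : int => i%:~R : F) (tri_exp01 j).
  rewrite !rmorphM rmorphB /= -pmulrn => e.
  rewrite -[LHS]addr0 -(mul0r (tri_exp 0 1 j)%:R) -F7_7.
  have -> : t = 1 - 2%:R * j%:~R by rewrite /t rmorphB rmorphM.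
  transitivity (1 + 4%:R * (2%:~R * (tri_exp 0 1 j)%:R) : F).
    by ring.
  by rewrite e; ring.
have m3 : (m%:R : F) ^+ 3 = 1.
  rewrite -natrX -(natr_mod_F7 (m ^ 3)) -modnXm.
  by case: m14 => ->.
transitivity (m%:R ^+ 3 * (s * t ^+ 7)); first by ring.
by rewrite m3 mul1r F7_fermat.
Qed.


Let w := 3%:R * al - x - 2%:R * y.

Lemma dcube_unit : dcube \is a GRing.unit.
Proof.
by rewrite dcubeE unitrM two_unit unitrX.
Qed.

Lemma cubic_w : cubic D w = 1.
Proof.
have fu : fps_dil 4 dcube \is a GRing.unit.
  by rewrite dcube4E unitrM two_unit unitrX.
apply: (mulIr fu); rewrite mul1r -(@cubicE _ D DA DM 4%:R) ?fps_D_nat //.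
  by apply: dcube_cubic; right.
rewrite dcube4E DM fps_DX fps_D_nat D4.
transitivity ((3%:R * l4 + 4%:R) * (2%:R * E 4 ^+ 3)); first by ring.
congr (_ * _); apply: (@eq_mod7 _ _ (3%:R * al - x + 2%:R * y - 3%:R * l4)).
transitivity (4%:R * (1 + 6%:R * l4) - 21%:R * l4); first by ring.
by rewrite log_E4 be_al /w; ring.
Qed.

Lemma cubic_w4 : cubic D (w + 4%:R * x) = 1.
Proof.
apply: (mulIr dcube_unit); rewrite mul1r -(@cubicE _ D DA DM 1%:R) ?fps_D_nat //.
  have := @dcube_cubic 1 (or_introl erefl).
  rewrite (_ : fps_dil 1 dcube = dcube) //.
  by apply: fpsP => n; rewrite fps_dilE dvd1n divn1.
rewrite dcubeE DM fps_DX fps_D_nat D1.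
transitivity ((3%:R * l1 + 1) * (2%:R * E 1 ^+ 3)); first by ring.
congr (_ * _).
apply: (@eq_mod7 _ _ (3%:R * al - 5%:R * x + 5%:R * y - 3%:R * l1)).
transitivity (3%:R * (4%:R * (2%:R * l1)) + 1 - 21%:R * l1); first by ring.
rewrite log_E1; transitivity (12%:R * be + 3%:R * (4%:R * l2) + 1 - 21%:R * l1).
  by ring.
rewrite log_E2.
transitivity (15%:R * be + 3%:R * al + (1 + 6%:R * l4) - 21%:R * l1); first by ring.
by rewrite log_E4 be_al /w; ring.
Qed.

Lemma x_reg u : x * u = 0 -> u = 0.
Proof. by move=> xu; apply: (mulrI (unitrX 4 phi_unit)); rewrite xu mulr0. Qed.

(** ** A section of [phi / (f_2 f_4)] *)

Let h := phi * (E 2 * E 4) ^+ 6.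

Lemma D_h : D h = (x - 3%:R * y - al + 2%:R) * h.
Proof.
rewrite DM fps_DX DM Dphi D2 D4.
transitivity ((al + 6%:R * l2 + 6%:R * l4) * h); first by rewrite /h; ring.
congr (_ * _).
apply: (@eq_mod7 _ _ (8%:R * al - 5%:R * x + 6%:R * y - 1 - 6%:R * l2)).
transitivity (al + 12%:R * (4%:R * l2) + 6%:R * l4 - 42%:R * l2); first by ring.
rewrite log_E2.
transitivity (8%:R * al + 12%:R * be + 5%:R * (1 + 6%:R * l4) - 5%:R + 5%:R * al -
  42%:R * l2); first by ring.
by rewrite log_E4 be_al; ring.
Qed.

Let g := phi ^+ 3 * (E 2 * E 4) ^+ 2.

(** Here [x - y] is replaced by [16 q f_4^6 / (phi(q) phi(-q))], after which
    everything but [q^2] is a seventh power. *)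
Lemma h_hasse : 2%:R * x ^+ 6 * y * (x - y) ^+ 2 * h = 'q^2 * g ^+ 7.
Proof.
have S := phi4_sub_phim4 F; rewrite -/x -/y in S.
have ppu : (phi * phim) ^+ 2 \is a GRing.unit.
  by rewrite unitrX // unitrM phi_unit phim_unit.
apply: (mulrI ppu).
transitivity (2%:R * phi ^+ 25 * phim ^+ 4 * (phi * phim * (x - y)) ^+ 2 *
  (E 2 * E 4) ^+ 6); first by rewrite /h /x /y; ring.
rewrite S; transitivity (512%:R * ('q^1 ^+ 2) * phi ^+ 21 * (phi * phim * E 4 ^+ 2) ^+ 4 *
  E 4 ^+ 10 * E 2 ^+ 6); first by ring.
rewrite fps_X_exp mul1n; transitivity ('q^2 * phi ^+ 21 * (phi * phim * E 4 ^+ 2) ^+ 2 *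
   (phi * phim * E 4 ^+ 2) ^+ 2 * E 4 ^+ 10 * E 2 ^+ 6).
  apply: (@eq_mod7 _ _ (73%:R * ('q^2 * phi ^+ 21 * (phi * phim * E 4 ^+ 2) ^+ 4 *
    E 4 ^+ 10 * E 2 ^+ 6))).
  by ring.
by rewrite {2}phi_phim /g; ring.
Qed.

(** At exponents [7 n + 2] the operator [(D - 2)^6] is 0. *)
Lemma sec_h : fps_sec 7 2 h = g.
Proof.
have := iter6_shifted_D F7_char DA DM x_reg D_x D_y al_sub_be cubic_w cubic_w4 D_h.
set e := fun u : fps F => D u - 2%:R * u.
have coef_e u n : e u n = (n%:R - 2%:R) * u n.
  by rewrite /e fpsBE -(rmorph_nat (@fps_const F)) fps_constME mulrBl.
have coef_iter k u n : iter k e u n = (n%:R - 2%:R) ^+ k * u n.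
  by elim: k => [|k IH]; rewrite ?mul1r // iterS coef_e IH exprS mulrA.
rewrite mulrBl mul1r h_hasse => e6.
have : fps_sec 7 2 (iter 6 e h) = 0.
  apply: fpsP => n; rewrite [LHS](coef_iter 6 h (7 * n + 2)%N).
  by rewrite natrD natrM F7_7 mul0r add0r subrr expr0n mul0r.
rewrite e6 raddfB /= fps_frobenius7 mulrC fps_sec_dilM // => /eqP.
rewrite subr_eq0 => /eqP ->; rewrite -[RHS]mulr1; congr (_ * _).
apply: fpsP => n; rewrite fps1E [LHS](fps_qE _ 2 (7 * n + 2)).
by congr (_%:R); lia.
Qed.

(** The series [b] differs from [h] by the seventh power of [f_2 f_4]. *)
Theorem sec_phi_quotient (b : fps F) : b * (E 2 * E 4) = phi ->
  fps_sec 7 2 b = phi ^+ 3 * (E 2 * E 4).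
Proof.
move=> bE; have u24 : E 2 * E 4 \is a GRing.unit by rewrite unitrM u2 u4.
apply: (mulIr u24); transitivity (fps_sec 7 2 h); last by rewrite sec_h /g; ring.
rewrite /h -bE (_ : b * _ * _ = (E 2 * E 4) ^+ 7 * b); last by ring.
by rewrite fps_frobenius7 fps_sec_dilM // mulrC.
Qed.

(** The left hand side is [phi^3 f_2 f_4 chi(q^2)], and
    [phi f_2 = f_1(-q)^2]; the remaining factors combine to [f_1(q) f_1(-q)]. *)
Theorem sec_weighted (b : fps F) : b * (E 2 * E 4) = phi ->
  fps_sec 7 2 (fps_dil 14 (chi F) * b) = fps_dil 7 (fps_alt (E 1)) * E 1.
Proof.
move=> bE; rewrite -(@fps_dil_dil _ 7 2) // fps_sec_dilM // sec_phi_quotient //.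
have c2 : fps_dil 2 (chi F) * E 4 ^+ 2 = E 2 ^+ 5.
  have := congr1 (fps_dil 2) (chi_euler F7_two).
  by rewrite fps_dilM // !fps_dilX // !euler_dil.
apply: (mulIr u4).
transitivity ((phi * E 2) ^+ 3 * E 2 ^+ 3).
  transitivity (fps_dil 2 (chi F) * E 4 ^+ 2 * phi ^+ 3 * E 2); first by ring.
  by rewrite c2; ring.
rewrite phi_euler -euler_alt_mul -fps_frobenius7.
by ring.
Qed.

(** ** Pentagonal numbers modulo 7 *)

Lemma residue7 (k : int) : exists c s : int, k = 7 * c + s /\
  (s = 0 \/ s = 1 \/ s = 2 \/ s = 3 \/ s = 4 \/ s = 5 \/ s = 6).
Proof. by exists (k %/ 7)%Z, (k %% 7)%Z; lia. Qed.

Lemma sec_euler_pentagonal j : j \in [:: 3; 4; 6]%N -> fps_sec 7 j (E 1) = 0.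
Proof.
move=> hj; apply: fpsP => n; apply/eqP; apply: contraT => nz.
have {nz} : E 1 (7 * n + j)%N != 0 by exact: nz.
rewrite pentagonal => /wsum_supp[k ek]; have := tri_exp12 k; rewrite ek.
have [c [s [-> hs]]] := residue7 k; move: hj hs; rewrite !inE.
by case/or3P=> /eqP ->; (do 6?[case]) => -> eh; exfalso; nia.
Qed.

Lemma sec_alt_euler_pentagonal j : j \in [:: 3; 4; 6]%N ->
  fps_sec 7 j (fps_alt (E 1)) = 0.
Proof.
move=> hj; apply: fpsP => n; have := sec_euler_pentagonal hj.
move=> /(congr1 (fun u : fps F => u n)) /= ->.
by rewrite mulr0.
Qed.

(** [k (3 k - 1) / 2 = 7 n + 2] means [(6 k - 1)^2 = 49 + 168 n], and then
    49 divides the left hand side. *)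
Lemma sec_euler_2 r : (0 < r < 7)%N -> fps_sec 7 r (fps_sec 7 2 (E 1)) = 0.
Proof.
move=> hr; apply: fpsP => n; apply/eqP; apply: contraT => nz.
have {nz} : E 1 (7 * (7 * n + r) + 2)%N != 0 by exact: nz.
rewrite pentagonal => /wsum_supp[k ek]; have := tri_exp12 k; rewrite ek.
have [c [s [-> hs]]] := residue7 k; move: hs.
by (do 6?[case]) => -> eh; exfalso; nia.
Qed.

Lemma sec_euler_dil : exists v, fps_sec 7 2 (E 1) = fps_dil 7 v.
Proof.
exists (fps_sec 7 0 (fps_sec 7 2 (E 1))); apply: (@fps_ext_sec _ 7) => // r r7.
rewrite fps_sec_dil //; case: eqP => [->//|r0].
by apply: sec_euler_2; lia.
Qed.

Theorem coef_weighted_49 (b : fps F) n j : b * (E 2 * E 4) = phi ->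
  j \in [:: 3; 4; 6]%N -> (fps_dil 14 (chi F) * b) (49 * n + 7 * j + 2)%N = 0.
Proof.
move=> bE hj; have j7 : (j < 7)%N by move: hj; rewrite !inE => /or3P[] /eqP ->.
transitivity (fps_sec 7 j (fps_sec 7 2 (fps_dil 14 (chi F) * b)) n).
  by rewrite (_ : 49 * n + 7 * j + 2 = 7 * (7 * n + j) + 2)%N //; lia.
by rewrite sec_weighted // fps_sec_dilM // sec_euler_pentagonal // mulr0.
Qed.

Theorem coef_weighted_343 (b : fps F) n j : b * (E 2 * E 4) = phi ->
  j \in [:: 3; 4; 6]%N -> (fps_dil 14 (chi F) * b) (343 * n + 49 * j + 16)%N = 0.
Proof.
move=> bE hj; have j7 : (j < 7)%N by move: hj; rewrite !inE => /or3P[] /eqP ->.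
transitivity (fps_sec 7 j (fps_sec 7 2 (fps_sec 7 2 (fps_dil 14 (chi F) * b))) n).
  rewrite (_ : 343 * n + 49 * j + 16 = 7 * (7 * (7 * n + j) + 2) + 2)%N //.
  by lia.
have [v ev] := sec_euler_dil.
rewrite sec_weighted // fps_sec_dilM // ev mulrC fps_sec_dilM //.
by rewrite sec_alt_euler_pentagonal // mulr0.
Qed.

End ModSeven.

(** * Generating functions of partitions *)

Section GeneratingFunctions.
Variable K : fieldType.

(** A list of the objects of weight [n], rather than the cardinal of a finite type:
    no bound depending on [n] enters the constructions below. *)
Definition has_gf (T : eqType) (Q : pred T) (wt : T -> nat) (G : fps K) :=
  forall n, exists l : seq T,
    [/\ uniq l, l =i [pred s | Q s & wt s == n] & G n = (size l)%:R].

Lemma has_gf_prod (T T' : eqType) (Q : pred T) (Q' : pred T') wt wt' G G' :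
  has_gf Q wt G -> has_gf Q' wt' G' ->
  has_gf (fun p : T * T' => Q p.1 && Q' p.2) (fun p => wt p.1 + wt' p.2)%N (G * G').
Proof.
move=> /boolp.choice[l lP] /boolp.choice[l' lP'] n.
pose t i := [seq (s, s') | s <- l i, s' <- l' (n - i)%N].
have tP i p : reflect [/\ Q p.1, Q' p.2, wt p.1 = i & wt' p.2 = n - i]%N (p \in t i).
  have [_ lE _] := lP i; have [_ lE' _] := lP' (n - i)%N.
  case: p => s s'; rewrite /t; apply: (iffP allpairsP) => [[[a b]]|] /=.
    by rewrite lE lE' => -[/andP[sQ /eqP ws] /andP[sQ' /eqP ws'] [-> ->]].
  move=> [sQ sQ' ws ws']; exists (s, s').
  by rewrite lE lE' !inE sQ sQ' ws ws' !eqxx.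
exists [seq p | i <- iota 0 n.+1, p <- t i]; split.
- apply: allpairs_uniq_dep => [|i _|]; first exact: iota_uniq.
    have [u _ _] := lP i; have [u' _ _] := lP' (n - i)%N.
    by apply: allpairs_uniq => // -[? ?] [? ?].
  move=> a b /allpairsPdep[i [p [_ /tP[_ _ wp _] ->]]].
  move=> /allpairsPdep[j [p' [_ /tP[_ _ wp' _] ->]]] /= e.
  by move: wp wp'; rewrite e => -> ->.
- move=> p; apply/allpairsPdep/idP => [[i [p' [i_n /tP[pQ pQ' wp wp'] ->]]]|].
    rewrite inE pQ pQ' wp wp'; move: i_n; rewrite mem_iota => i_n.
    by apply/eqP; lia.
  rewrite inE => /andP[/andP[pQ pQ'] /eqP wp]; exists (wt p.1), p.
  by split=> //; [rewrite mem_iota; lia|apply/tP; split=> //; lia].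
- rewrite fpsME size_allpairs_dep sumnE big_map natr_sum.
  rewrite -(big_mkord xpredT (fun i => G i * G' (n - i)%N)) /index_iota subn0.
  apply: eq_bigr => i _; rewrite size_allpairs natrM.
  by have [_ _ ->] := lP i; have [_ _ ->] := lP' (n - i)%N.
Qed.

Lemma has_gf_map (T T' : eqType) (Q : pred T) (Q' : pred T') wt wt' G
    (f : T -> T') (g : T' -> T) :
  (forall s, Q s -> Q' (f s) /\ g (f s) = s) ->
  (forall t, Q' t -> Q (g t) /\ f (g t) = t) ->
  (forall s, Q s -> wt' (f s) = wt s) ->
  has_gf Q wt G -> has_gf Q' wt' G.
Proof.
move=> fP gP fwt GP n; have [l [ul lE Gn]] := GP n; exists (map f l).
have lQ s : s \in l -> Q s by rewrite lE => /andP[].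
split; last by rewrite size_map.
  rewrite map_inj_in_uniq // => s t /lQ sQ /lQ tQ e.
  by have [_ <-] := fP s sQ; rewrite e; have [_ ->] := fP t tQ.
move=> t; rewrite [RHS]/=; apply/mapP/andP => [[s sl ->]|[tQ /eqP tn]].
  move: (sl); rewrite lE => /andP[sQ /eqP sn].
  by have [-> _] := fP s sQ; rewrite fwt // sn.
have [gQ fg] := gP t tQ; exists (g t) => //.
by rewrite lE inE gQ -(fwt _ gQ) fg tn eqxx.
Qed.

(** ** Partitions with prescribed multiplicities *)

Variable ok : nat -> nat -> bool.

(** The condition bears on the parts that occur, so that multiplicity 0 is
    permitted for every part. *)
Definition mult_ok (s : seq nat) := all (fun i => ok i (count_mem i s)) s.

(** The sum of [q^(M k)] over the permitted multiplicities [k] of the part [M]. *)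
Definition part_factor M : fps K :=
  Fps (fun n => ((M %| n)%N && ((n == 0%N) || ok M (n %/ M)))%:R).

Lemma part_factor_gf M : (0 < M)%N ->
  has_gf (fun k => (k == 0%N) || ok M k) (fun k => k * M)%N (part_factor M).
Proof.
move=> M0 n; exists [seq k <- [:: n %/ M]%N | (M %| n)%N & (k == 0%N) || ok M k].
split; first by rewrite filter_uniq.
- move=> k; rewrite mem_filter !inE; apply/andP/andP => [[/andP[Mn kQ] /eqP ek]|].
    by rewrite kQ ek divnK.
  by case=> kQ /eqP <-; rewrite dvdn_mull // mulnK // kQ.
- rewrite /=; case: (boolP (M %| n)%N) => //= /dvdnP[k ->].
  by rewrite mulnK // muln_eq0 (gtn_eqF M0) orbF; case: ifP.
Qed.

Let geq_trans : transitive geq.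
Proof. by move=> a b c /= h1 h2; apply: leq_trans h2 h1. Qed.

Lemma sorted_geq_split M s : sorted geq s -> all (geq M) s ->
  s = nseq (count_mem M s) M ++ [seq i <- s | i != M].
Proof.
elim: s => //= a s IH pas /andP[aM sM].
have /IH/(_ sM) {IH} es := path_sorted pas.
case: eqP => [->|/eqP naM] /=; first by congr cons.
have sa : all (geq a) s by exact: order_path_min geq_trans pas.
have s_neq i : i \in s -> i != M.
  by move=> /(allP sa) /= ia; move: aM naM => /=; lia.
rewrite add0n (_ : count_mem M s = 0%N) /=; last first.
  by apply/count_memPn/negP => /s_neq; rewrite eqxx.
by congr cons; apply/esym/all_filterP/allP.
Qed.

Definition bounded_part m s := [&& is_partition s, all (geq m) s & mult_ok s].

Definition part_gf m : fps K := \prod_(i < m) part_factor i.+1.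

(** A partition with parts at most [m + 1] is a block of parts [m + 1] followed by
    a partition with parts at most [m]. *)
Lemma bounded_part_gf m : has_gf (bounded_part m) sumn (part_gf m).
Proof.
elim: m => [|m IH].
  move=> n; exists (if n == 0%N then [:: [::]] else [::]); split.
  - by case: ifP.
  - move=> s; rewrite [RHS]inE /bounded_part /is_partition.
    case: s => [|a s] /=; first by case: n.
    rewrite leqn0 inE negb_or; case: (a == 0%N) / eqP => [->|].
      by rewrite /= !andbF; case: ifP.
    by rewrite !andbF /=; case: ifP.
  - by rewrite /part_gf big_ord0 fps1E; case: ifP.
rewrite /part_gf big_ord_recr /= mulrC.
pose f (p : nat * seq nat) := nseq p.1 m.+1 ++ p.2.
pose g (s : seq nat) := (count_mem m.+1 s, [seq i <- s | i != m.+1]).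
apply: (has_gf_map (f := f) (g := g) _ _ _ (has_gf_prod (part_factor_gf (ltn0Sn m)) IH)).
- move=> [k s] /= /andP[kQ /and3P[/andP[ss s0] sm sQ]].
  have sM : m.+1 \notin s by apply/negP => /(allP sm) /=; rewrite ltnn.
  have cM : count_mem m.+1 s = 0%N by apply/count_memPn.
  split; last first.
    rewrite /g /f /= count_cat count_nseq /= eqxx mul1n cM addn0 filter_cat.
    rewrite (_ : [seq i <- nseq k _ | _] = [::]) /=; last first.
      by rewrite filter_nseq eqxx.
    congr (_, _); apply/all_filterP/allP => i si.
    by apply: contraNneq sM => <-.
  apply/and3P; split.
  - rewrite /is_partition mem_cat negb_or s0 mem_nseq andbF !andbT.
    move: ss; rewrite !(sorted_pairwise geq_trans) pairwise_cat => ->.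
    rewrite andbT /allrel all_nseq /= (sub_all _ sm) ?orbT /=; last first.
      by move=> i /= /leqW.
    by elim: (k) => //= k' ->; rewrite all_nseq /= leqnn orbT.
  - rewrite all_cat all_nseq /= leqnn orbT /=.
    by apply: sub_all sm => i /= ?; apply: leqW.
  - apply/allP => i; rewrite mem_cat mem_nseq count_cat count_nseq /=.
    case: (eqVneq i m.+1) => [->|iM] /=.
      rewrite cM ?eqxx (negbTE sM) mul1n addn0 orbF andbT.
      by move: kQ; case: eqP => //= ->.
    by rewrite andbF /= mul0n add0n => /(allP sQ).
- move=> s /and3P[/andP[ss s0] sm sQ]; split; last by rewrite /f /g /= -sorted_geq_split.
  rewrite /g /=; apply/andP; split.
    case: (boolP (m.+1 \in s)) => [/(allP sQ) ->|/count_memPn ->] //.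
    by rewrite orbT.
  apply/and3P; split.
  - rewrite /is_partition mem_filter negb_and s0 orbT andbT.
    exact: sorted_filter geq_trans _ _ ss.
  - apply/allP => i; rewrite mem_filter => /andP[iM /(allP sm)] /=.
    by rewrite leq_eqVlt (negbTE iM).
  - apply/allP => i; rewrite mem_filter => /andP[iM /(allP sQ)].
    rewrite count_filter; congr (ok i _); apply: eq_count => a /=.
    by case: eqP => //= ->.
- by move=> [k s] _; rewrite /f /= sumn_cat sumn_nseq mulnC.
Qed.

Lemma part_gf_stable n : eqmod n (part_gf n.+1) (part_gf n).
Proof.
rewrite /part_gf big_ord_recr -[X in eqmod _ _ X]mulr1; apply: eqmodM => //.
move=> k kn; rewrite fps1E /=; case: (posnP k) => [->|k0]; first by rewrite dvdn0.
by rewrite gtnNdvd ?(gtn_eqF k0) //; lia.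
Qed.

Lemma partition_gf :
  has_gf (fun s => is_partition s && mult_ok s) sumn (fps_lim part_gf).
Proof.
move=> n; have [l [ul lE ln]] := bounded_part_gf n.+1 n.
exists l; split=> // s; rewrite lE !inE /bounded_part.
case: (boolP (is_partition s)) => //= _; case: eqP => [sn|]; last by rewrite !andbF.
rewrite !andbT (_ : all _ s = true) //; apply/allP => i /= si.
by apply: leqW; rewrite -sn; elim: s si {sn} => //= a s IH;
  rewrite inE => /orP[/eqP->|/IH]; lia.
Qed.

End GeneratingFunctions.

Section TripleCount.
Variable K : fieldType.
Local Notation E := (euler K).

Definition ok_odd (i k : nat) := odd i && (k == 1%N).
Definition ok_4 (i k : nat) := (4 %| i)%N.

Lemma mult_ok_odd s : mult_ok ok_odd s = uniq s && all odd s.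
Proof.
rewrite /mult_ok (eq_all (a2 := predI odd (fun i => count_mem i s == 1%N))) //.
rewrite all_predI andbC; congr (_ && _); apply/allP/idP => [h|us i si].
  apply: count_mem_uniq => i; case: (boolP (i \in s)) => [/h/eqP //|].
  by move/count_memPn.
by rewrite count_uniq_mem // si.
Qed.

Lemma mult_ok_4 s : mult_ok ok_4 s = all (dvdn 4) s. Proof. by []. Qed.

Lemma part_factor_odd M : (0 < M)%N ->
  part_factor K ok_odd M = if odd M then 1 + 'q^M else 1.
Proof.
move=> M0; apply: fpsP => n; rewrite [LHS]/= /ok_odd.
case: (posnP n) => [->|n0].
  rewrite dvdn0 /=; case: (odd M); rewrite ?fpsDE fps1E // fps_qE (ltn_eqF M0).
  by rewrite addr0.
rewrite /=; case: (odd M); last by rewrite andbF fps1E (gtn_eqF n0).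
rewrite fpsDE fps1E (gtn_eqF n0) add0r fps_qE; congr (_%:R); congr nat_of_bool.
apply/andP/eqP => [[/dvdnP[k ->]]|->]; last by rewrite dvdnn divnn M0.
by rewrite mulnK // => /eqP ->; rewrite mul1n.
Qed.

Lemma part_factor_4 M : (0 < M)%N ->
  part_factor K ok_4 M * (if (4 %| M)%N then 1 + fps_const (-1) * 'q^M else 1) = 1.
Proof.
move=> M0; apply: fpsP => n; rewrite mulrC fps1E /part_factor /ok_4.
set u := Fps _; case: ifP => M4.
  rewrite rmorphN1 mulN1r mulrDl mul1r mulNr fpsBE fpsXME /u M4 /= !orbT !andbT.
  case: leqP => nM; first by rewrite dvdn_subl // subrr (gtn_eqF (leq_trans M0 nM)).
  by rewrite subr0; case: (posnP n) => [->|n0]; rewrite ?dvdn0 // gtnNdvd // (gtn_eqF n0).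
rewrite mul1r /u /= M4 orbF; congr (_%:R); congr nat_of_bool.
by case: eqP => [->|]; rewrite ?dvdn0 // andbF.
Qed.

Lemma odd_gf : fps_lim (part_gf K ok_odd) = oddp K.
Proof.
apply: eqmodP => N; apply: (@eqmod_trans _ _ (part_gf K ok_odd (N * 2))).
  apply: (eqmod_le (leq_pmulr N (isT : (0 < 2)%N))).
  by apply: fps_lim_eqmod => n; apply: part_gf_stable.
apply: eqmod_sym; apply: (eqmod_trans (qprod_eqmod 1 1 (isT : (0 < 2)%N) (leqnn N))).
rewrite /part_gf (prod_residues (fun i => part_factor K ok_odd i.+1)).
rewrite !big_ord_recr big_ord0 /= mul1r [X in _ * X]big1 ?mulr1 => [|i _].
  move=> k _; congr (coef _ k); apply: eq_bigr => i _.
  rewrite part_factor_odd // rmorph1 mul1r.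
  by rewrite ifT ?addn0; [congr (_ + 'q^_)|]; lia.
by rewrite part_factor_odd // ifF //; lia.
Qed.

Lemma mult4_gf : fps_lim (part_gf K ok_4) * E 4 = 1.
Proof.
apply: eqmodP => N.
apply: (@eqmod_trans _ _ (part_gf K ok_4 (N * 4) * qfin (-1) 4 4 N)).
  apply: eqmodM; last exact: qprod_eqmod.
  apply: (eqmod_le (leq_pmulr N (isT : (0 < 4)%N))).
  by apply: fps_lim_eqmod => n; apply: part_gf_stable.
have one M : (0 < M)%N -> ~~ (4 %| M)%N -> part_factor K ok_4 M = 1.
  by move=> M0 M4; have := part_factor_4 M0; rewrite (negbTE M4) mulr1.
rewrite /part_gf (prod_residues (fun i => part_factor K ok_4 i.+1)).
rewrite !big_ord_recr big_ord0 /= mul1r.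
do 3![rewrite big1 ?mul1r => [|i _]; last by apply: one => //; lia].
rewrite /qfin -big_split big1 // => i _ /=.
have := @part_factor_4 (i * 4 + 3).+1 isT; rewrite ifT; last by lia.
by rewrite (_ : (4 + 4 * i = (i * 4 + 3).+1)%N) //; lia.
Qed.

Lemma Bnat_gf : Fps (fun n => (Bnat n)%:R) = oddp K * oddp K * fps_lim (part_gf K ok_4).
Proof.
have godd := partition_gf K ok_odd; rewrite odd_gf in godd.
have g4 := partition_gf K ok_4.
apply: fpsP => n; have [l [ul lE ->]] := has_gf_prod (has_gf_prod godd godd) g4 n.
rewrite [LHS]/=; congr (_%:R); rewrite /Bnat cardE; set A := enum _.
pose p (t : parts_upto n * parts_upto n * parts_upto n) :=
  (parts t.1.1, parts t.1.2, parts t.2).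
rewrite -(size_map p); apply/eqP; rewrite eqn_leq; apply/andP.
have p_inj : injective p.
  move=> [[a b] c] [[a' b'] c'] [/parts_inj ea /parts_inj eb /parts_inj ec].
  by rewrite /= in ea eb ec; rewrite ea eb ec.
have tE s1 s2 s3 : ((s1, s2, s3) \in l) = is_partition_triple n s1 s2 s3.
  rewrite lE inE /= !mult_ok_odd mult_ok_4 /is_partition_triple.
  case: (is_partition s1) => //=; case: (is_partition s2); rewrite ?andbF //=.
  case: (is_partition s3); rewrite ?andbF //=.
  by case: (uniq s1 && _) => //=; case: (uniq s2 && _).
have um : uniq (map p A) by rewrite (map_inj_uniq p_inj) enum_uniq.
have mA t : (t \in A) = is_partition_triple n (parts t.1.1) (parts t.1.2) (parts t.2).
  by rewrite mem_enum inE.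
split.
  apply: (uniq_leq_size um) => x /mapP[t].
  by rewrite mA => ht ->; rewrite tE.
apply: (uniq_leq_size ul) => -[[s1 s2] s3]; rewrite tE => hs.
have [t [e1 e2 e3]] := is_partition_triple_bounded hs.
apply/mapP; exists t; last by rewrite /p e1 e2 e3.
by rewrite mA e1 e2 e3.
Qed.

End TripleCount.

(** * The weighted sums *)

Section Conclusion.
Local Notation F := 'F_7.

Lemma F7_expf (t : F) : t ^+ 7 = t.
Proof. by have := expf_card t; rewrite card_Fp. Qed.

Definition Bser : fps F := Fps (fun n => (Bnat n)%:R).

Lemma Bser_phi : Bser * (euler F 2 * euler F 4) = phi F.
Proof.
rewrite /Bser Bnat_gf phi_prod; set c := fps_lim _.
rewrite -[RHS]mulr1 -(mult4_gf F) -/c expr2.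
by ring.
Qed.

(** The exponent of [chi(q^14)] is [14 k (3 k + 1) / 2 = 7 k (3 k + 1)], and the
    convention for negative arguments of [B] matches the range of a Cauchy
    product. *)
Lemma weighted_sumE (N : nat) :
  (\sum_(k \in [set: int]) (6 * k + 1) * (B (N%:Z - 7 * k * (3 * k + 1)))%:Z)%:~R =
  (fps_dil 14 (chi F) * Bser) N.
Proof.
have p21 : proper (fun k => 14 * tri_exp 2 1 k)%N.
  by apply: proper_mul => //; apply: tri_exp_proper.
have BE k : B (N%:Z - 7 * k * (3 * k + 1)) =
    if (14 * tri_exp 2 1 k <= N)%N then Bnat (N - 14 * tri_exp 2 1 k)%N else 0%N.
  have := tri_exp21 k => e.
  have {e} -> : 7 * k * (3 * k + 1) = (14 * tri_exp 2 1 k)%N%:Z by nia.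
  case: leqP => kN; first by rewrite subzn.
  have : N%:Z - (14 * tri_exp 2 1 k)%N%:Z < 0 by lia.
  by case: (N%:Z - _).
rewrite /chi wsum_dil // wsum_mulE //; have [r ur re] := proper_uniq N p21.
have out k : k \notin r -> (14 * tri_exp 2 1 k <= N)%N = false.
  by move=> kr; apply: contraNF kr; apply: re.
rewrite !(fsbigE r) //.
- rewrite rmorph_sum; apply: eq_bigr => k _; rewrite rmorphM /= BE.
  by case: ifP => // _; congr (_ * _); rewrite -pmulrn.
- by move=> k _ /out ->; rewrite mulr0.
- by move=> k _ /out kN; rewrite BE kN mulr0.
Qed.

Lemma eqz_mod7 (z : int) : z%:~R = 0 :> F -> (z = 0 %[mod 7])%Z.
Proof.
have pF : 7%N \in [pchar F] by exact: pchar_Fp.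
by move=> /eqP z0; apply/eqP; rewrite eqz_mod_dvd subr0 (dvdz_pcharf pF).
Qed.

End Conclusion.

Theorem theorem1p7 (n j : nat) (hj : j \in [:: 3; 4; 6]%N) :
  (\sum_(k \in [set: int])
      (6 * k + 1) *
        (B (49 * n%:Z + 7 * j%:Z + 2 - 7 * k * (3 * k + 1)))%:Z
    = 0 %[mod 7])%Z
  /\
  (\sum_(k \in [set: int])
      (6 * k + 1) *
        (B (343 * n%:Z + 49 * j%:Z + 16 - 7 * k * (3 * k + 1)))%:Z
    = 0 %[mod 7])%Z.
Proof.
have pF : 7%N \in [pchar 'F_7] by exact: pchar_Fp.
have -> : 49 * n%:Z + 7 * j%:Z + 2 = (49 * n + 7 * j + 2)%N%:Z by lia.
have -> : 343 * n%:Z + 49 * j%:Z + 16 = (343 * n + 49 * j + 16)%N%:Z by lia.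
split; apply: eqz_mod7; rewrite weighted_sumE.
  exact: (coef_weighted_49 pF F7_expf n Bser_phi hj).
exact: (coef_weighted_343 pF F7_expf n Bser_phi hj).
Qed.
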